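(* Let $\sigma$ be the endomorphism of the free group $F(a,b,c,d)$ defined by $\sigma(a)=aca$, $\sigma(b)=d$, $\sigma(c)=b$, $\sigma(d)=c$, and consider the finite presentation $$\Gamma_t=\langle\, a,b,c,d,t \ \|\ a^2,\ b^2,\ c^2,\ d^2,\ bcd,\ (ad)^4,\ (adacac)^4,\ \ tgt^{-1}\sigma(g)^{-1},\ g\in\{a,b,c,d\}\,\rangle .$$ There is a constant $C_2>1$ such that, for $j=0,1,2$, the Dehn $j$-function $f_{j,\Gamma_t}(x)$ of this presentation satisfies $f_{j,\Gamma_t}(x)\le C_2\,2^x x$ for all integers $x\ge 1$.
   Context: Presentations. For a finite alphabet $\mathcal{A}$, let $\mathcal{A}^{\pm1}=\mathcal{A}\cup\mathcal{A}^{-1}$, $F(\mathcal{A})$ the free group over $\mathcal{A}$, and $|W|$ the length of a word $W$ over $\mathcal{A}^{\pm1}$. The relator set $\mathcal{R}$ of a presentation $\langle\mathcal{A}\,\|\,\mathcal{R}\rangle$ consists of nonempty cyclically reduced words over $\mathcal{A}^{\pm1}$; $\langle\langle\mathcal{R}\rangle\rangle$ is its normal closure in $F(\mathcal{A})$. A word $W$ over $\mathcal{A}^{\pm1}$ is said to be in $\langle\langle\mathcal{R}\rangle\rangle$ if the element of $F(\mathcal{A})$ it represents is. Van Kampen diagrams. $K(\mathcal{A},\mathcal{R})$ is the standard presentation 2-complex: one 0-cell, oriented 1-cells in bijection with the letters of $\mathcal{A}^{\pm1}$ (a letter and its inverse corresponding to opposite orientations of one 1-cell), 2-cells in bijection with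 the words of $\mathcal{R}$, attached along these words. A van Kampen diagram over $\langle\mathcal{A}\,\|\,\mathcal{R}\rangle$ is a planar, finite, connected and simply connected 2-complex $\Delta$ with a continuous cellular map to $K(\mathcal{A},\mathcal{R})$ whose restriction to every (open) cell is a homeomorphism onto a cell. Thus each oriented edge $e$ carries a label $\varphi(e)\in\mathcal{A}^{\pm1}$ with $\varphi(e^{-1})=\varphi(e)^{-1}$, and the boundary of each 2-cell is labeled by a cyclic permutation of a word of $\mathcal{R}$ or its inverse. The label $\varphi(p)$ of a path $p=e_1\cdots e_k$ is $\varphi(e_1)\cdots\varphi(e_k)$. $\partial\Delta$ is the boundary path of $\Delta$, $\varphi(\partial\Delta)\equiv W$ means literal equality as cyclic words, and $|\Delta(j)|$ is the number of $j$-cells of $\Delta$. By van Kampen's lemma, $W\in\langle\langle\mathcal{R}\rangle\rangle$ if and only if there is a van Kampen diagram $\Delta$ with $\varphi(\partial\Delta)\equiv W$. Dehn $j$-functions. For $W\in\langle\langle\mathcal{R}\rangle\rangle$ and $j\in\{0,1,2\}$ let $L_j(W)=\min\{|\Delta(j)| : \varphi(\partial\Delta)\equiv W\}$, the minimum over van Kampen diagrams $\Delta$ over the presentation. The Dehn $j$-function is, for integers $x\ge1$, $f_j(x)=\max\{L_j(W) : W\in\langle\langle\mathcal{R}\rangle\rangle,\ |W|\le x\}$. *)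

(* Defs.v *)
From HB Require Import structures.
From mathcomp Require Import all_boot all_order all_algebra.
From mathcomp Require Import reals.

Set Implicit Arguments.
Unset Strict Implicit.
Unset Printing Implicit Defensive.

Section Words.
Variable A : finType.

(* (a, false) is the letter a, (a, true) is the letter a^-1. *)
Definition word : Type := seq (A * bool)%type.

Definition gen (a : A) : A * bool := (a, false).
Definition linv (l : A * bool) : A * bool := (l.1, ~~ l.2).
Definition winv (w : word) : word := rev (map linv w).
Definition wpow (w : word) (n : nat) : word := flatten (nseq n w).

Definition cyc_reduced (w : word) : bool := cycle (fun x y => y != linv x) w.

(* [free_eq u v] : the words u and v represent the same element of F(A). *)
Inductive free_eq : word -> word -> Prop :=
| FreeCancel u v l : free_eq (u ++ [:: l; linv l] ++ v) (u ++ v)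
| FreeRefl u : free_eq u u
| FreeSym u v : free_eq u v -> free_eq v u
| FreeTrans u v w : free_eq u v -> free_eq v w -> free_eq u w.

Record presentation := Presentation {
  relators : seq word;
  relatorsP : all (fun r => (r != [::]) && cyc_reduced r) relators
}.

(* [in_ncl P w] : the element of F(A) represented by w lies in the normal
   closure of the relators of P. *)
Inductive in_ncl (P : presentation) : word -> Prop :=
| NclRel r : r \in relators P -> in_ncl P r
| NclOne : in_ncl P [::]
| NclMul u v : in_ncl P u -> in_ncl P v -> in_ncl P (u ++ v)
| NclInv u : in_ncl P u -> in_ncl P (winv u)
| NclConj g u : in_ncl P u -> in_ncl P (g ++ u ++ winv g)
| NclFree u v : free_eq u v -> in_ncl P u -> in_ncl P v.

End Words.

(* A finite connected simply connected planar 2-complex is a finite connected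
   graph embedded in the plane together with all bounded components of its
   complement.  It is encoded by a rotation system:
   - vert, dart, cell are the 0-cells, the oriented edges and the 2-cells;
   - opp e is e^-1, and src e is the initial vertex of e;
   - next e is the edge following e on the boundary of the component of the
     complement of the graph lying to the left of e, so that e |-> next (opp e)
     turns around src e;
   - face e is the 2-cell to the left of e, or None if the component to the
     left of e is the unbounded one.
   The boundary components of the graph are thus the orbits of next, and the
   vertices (other than that of the one-vertex complex, which has no dart) are
   the orbits of next \o opp.  Planarity and simple connectedness are the Euler
   formula V - E + F = 1, where the unbounded component is not counted;
   #|dart|./2 is the number of unoriented edges.  If there are darts, an orbit
   of darts with face None exists, since V - E + (number of orbits of next)
   is even for a connected rotation system. *)
Record planar_complex := PlanarComplex {
  vert : finType;
  dart : finType;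
  cell : finType;
  opp : dart -> dart;
  next : dart -> dart;
  src : dart -> vert;
  face : dart -> option cell;
  oppK : involutive opp;
  opp_neq : forall e, opp e != e;
  next_inj : injective next;
  srcP : forall e e',
    (src e == src e') = fconnect (fun x => next (opp x)) e e';
  faceP : forall e e', (face e == face e') = fconnect next e e';
  face_surj : forall f : cell, exists e, face e = Some f;
  connP : forall v w : vert,
    connect (fun x y => [exists e, (src e == x) && (src (opp e) == y)]) v w;
  eulerP : #|vert| + #|cell| = #|dart|./2 + 1
}.

(* p is a closed path running once around the face c, from some starting edge;
   for c = None it is the boundary path of the complex, which is empty exactly
   when the complex is a single vertex. *)
Definition boundary_path (D : planar_complex) (c : option (cell D))
    (p : seq (dart D)) : Prop :=
  [/\ fcycle (@next D) p, uniq p & p =i [pred e | face e == c]].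

(* As the starting edge of a boundary path is arbitrary, equality of its label
   with a word is equality up to cyclic permutation.  A face lies to the left
   of its boundary path, so the boundary path for c = None runs opposite to
   those of the 2-cells as seen in the plane; relators are allowed to be read
   in both directions, so this is immaterial (reflect the diagram). *)
Record van_kampen_diagram (A : finType) (P : presentation A) := VanKampen {
  complex :> planar_complex;
  label : dart complex -> A * bool;
  label_opp : forall e, label (opp e) = linv (label e);
  label_cell : forall f : cell complex, exists p r,
    [/\ boundary_path (Some f) p, r \in relators P
      & map label p = r \/ map label p = winv r]
}.

Definition boundary_label (A : finType) (P : presentation A)
    (D : van_kampen_diagram P) (W : word A) : Prop :=
  exists p, boundary_path (D := D) None p /\ map (label (v := D)) p = W.

Definition ncells (j : 'I_3) (D : planar_complex) : nat :=
  match val j with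
  | 0 => #|vert D|
  | 1 => #|dart D|./2
  | _ => #|cell D|
  end.

(* [is_L P j W n] : L_j(W) = n. *)
Definition is_L (A : finType) (P : presentation A) (j : 'I_3) (W : word A)
    (n : nat) : Prop :=
  (exists D : van_kampen_diagram P, boundary_label D W /\ ncells j D = n) /\
  (forall D : van_kampen_diagram P, boundary_label D W -> n <= ncells j D).

(* [is_dehn P j x m] : f_j(x) is defined and equal to m. *)
Definition is_dehn (A : finType) (P : presentation A) (j : 'I_3) (x m : nat)
    : Prop :=
  [/\ forall W, in_ncl P W -> size W <= x -> exists n, is_L P j W n,
      exists W, [/\ in_ncl P W, size W <= x & is_L P j W m]
    & forall W n, in_ncl P W -> size W <= x -> is_L P j W n -> n <= m].

Inductive abcd := ga | gb | gc | gd.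

Definition abcd_code (g : abcd) : bool * bool :=
  match g with
  | ga => (false, false) | gb => (false, true)
  | gc => (true, false) | gd => (true, true)
  end.
Definition abcd_decode (x : bool * bool) : abcd :=
  match x with
  | (false, false) => ga | (false, true) => gb
  | (true, false) => gc | (true, true) => gd
  end.
Lemma abcd_codeK : cancel abcd_code abcd_decode.
Proof. by case. Qed.
HB.instance Definition _ := Finite.copy abcd (can_type abcd_codeK).

(* The endomorphism sigma of F(a,b,c,d), given by its values on generators. *)
Definition sigma (g : abcd) : word abcd :=
  match g with
  | ga => [:: gen ga; gen gc; gen ga]
  | gb => [:: gen gd]
  | gc => [:: gen gb]
  | gd => [:: gen gc]
  end.

(* The alphabet {a,b,c,d,t}, where t is None. *)
Definition abcdt : finType := option abcd.

Definition lift_word (w : word abcd) : word abcdt :=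
  [seq (Some l.1, l.2) | l <- w].

Definition t_letter : abcdt * bool := gen (None : abcdt).

(* t g t^-1 sigma(g)^-1 *)
Definition t_relator (g : abcd) : word abcdt :=
  [:: t_letter] ++ lift_word [:: gen g] ++ [:: linv t_letter]
    ++ winv (lift_word (sigma g)).

Definition Gamma_t_relators : seq (word abcdt) :=
  let a := gen ga in let b := gen gb in let c := gen gc in let d := gen gd in
  [seq lift_word w | w <- [::
      wpow [:: a] 2; wpow [:: b] 2; wpow [:: c] 2; wpow [:: d] 2;
      [:: b; c; d]; wpow [:: a; d] 4; wpow [:: a; d; a; c; a; c] 4]]
  ++ [seq t_relator g | g <- [:: ga; gb; gc; gd]].

Lemma Gamma_t_relatorsP :
  all (fun r => (r != [::]) && cyc_reduced r) Gamma_t_relators.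
Proof. by vm_compute. Qed.

Definition Gamma_t : presentation abcdt := Presentation Gamma_t_relatorsP.

(* Main.v *)
Require Import Defs.
From HB Require Import structures.
From mathcomp Require Import all_boot all_order all_algebra.
From mathcomp Require Import reals.
From mathcomp Require Import zify.
From Stdlib Require Import Classical.
(* path.v has its own [next] *)
Import Defs.

(** Moving t to the right and t^-1 to the left turns W, with m letters among
    a, b, c, d and k letters of each of t and t^-1, into t^-k w t^k, where w is a
    positive word of length at most m 2^(k+1) trivial in the Grigorchuk group.
    If w = (w0, w1) is the wreath decomposition, then
    w = sigma(w1) . a sigma(w0) a, and this costs O(|w|^2) relators: reading w
    letter by letter writes it as a product of conjugates (1, b^g) and (b^h, 1)
    with g, h in the dihedral group <a, d> of order 8, which are then sorted by
    commutations following from (ad)^4 and (adacac)^4.  As w0 and w1 have about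
    half the length of w and sigma is conjugation by t, w is killed with O(|w|^2)
    relators, that is O(m^2 4^k) = O(2^(m+2k)).

    Diagrams are built by adding spikes and 2-cells in the outer region only, so
    that no folding is needed.  Such moves undo every application of a relator
    that does not create letters out of nothing; insertions next to an existing
    letter are compositions of these moves because the link of the presentation
    complex is connected. *)

Set Implicit Arguments.
Unset Strict Implicit.
Unset Printing Implicit Defensive.

(** * Planar complexes *)


(** Everything about sigma rests on sigma(g) = (phi(g), g), where phi factors through the quotient
    of the Grigorchuk group by the normal closure of b, dihedral of order 8. Hence sigma preserves
    and reflects triviality, and a normal form t^-k w t^k can be tested on the binary tree. The
    quadratic bound survives the recursion because two sections of half the length cost together
    about half of what |w|^2 allows, so the costs form a geometric series. The factor x of the final
    bound comes only from collecting the letters t; filling w costs O(2^x), since m^2 is absorbed by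
    2^m. Free cancellations are counted along with relators, as they cost vertices and edges; a
    spike or a chord adds at most one cell of each dimension, so one count serves all three values
    of j. *)

Section Insertion.
Variables (T : finType) (g : T -> T) (e0 : T).

(** A permutation with one point spliced into a cycle. Adding an edge to a rotation system amounts
    to two such splices, one for each new dart. *)
Definition ins (z : option T) : option T :=
  if z is Some z then if z == e0 then None else Some (g z) else Some (g e0).

Lemma ins_inj : injective g -> injective ins.
Proof.
move=> gI [u|] [v|] //=.
- case: eqP => [->|ue]; case: eqP => [->|ve] // [] /gI -> //.
- by case: eqP => // ue [/gI].
- by case: eqP => // ve [/gI /esym].
Qed.

(** The new point joins the orbit of [e0], so orbits can be compared after sending it back to [e0];
    none is created or merged. *)
Lemma fconnect_ins u v : injective g ->
  fconnect ins u v = fconnect g (odflt e0 u) (odflt e0 v).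
Proof.
move=> gI; apply/idP/idP.
- case/connectP => p; elim: p u => [|w p IHp] u /=; first by move=> _ ->.
  case/andP => /eqP <- /IHp{}IHp /IHp{IHp}; apply: connect_trans.
  case: u => [u|] /=; last exact: fconnect1.
  by case: eqP => [->|_] //=; exact: fconnect1.
have step z : fconnect ins (Some z) (Some (g z)).
  case: (z =P e0) => [->|/eqP/negPf zN].
    apply: (@connect_trans _ _ None); apply: connect1 => //=.
    by rewrite eqxx.
  by apply: connect1; rewrite /= zN.
have some x y : fconnect g x y -> fconnect ins (Some x) (Some y).
  case/connectP => p; elim: p x => [|w p IHp] x /=; first by move=> _ ->.
  by case/andP=> /eqP <- /IHp{}IHp /IHp; apply: connect_trans.
have proj z : fconnect ins (Some (odflt e0 z)) z.
  by case: z => [z|] //=; apply: connect1; rewrite /= eqxx.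
move=> /some uv; apply: connect_trans (proj v).
rewrite (fconnect_sym (ins_inj gI)); apply: connect_trans (proj u).
by rewrite (fconnect_sym (ins_inj gI)).
Qed.

Lemma fcycle_ins_notin p : e0 \notin p -> fcycle g p ->
  fcycle ins (map Some p).
Proof.
move=> e0p; apply: (homo_cycle_in (P := [in p])); last by apply/allP.
move=> x y xp yp /= /eqP <-; case: (x =P e0) => [xe|_ //]; by rewrite -xe xp in e0p.
Qed.

Lemma fcycle_ins p : uniq (rcons p e0) -> fcycle g (rcons p e0) ->
  fcycle ins (rcons (map Some (rcons p e0)) None).
Proof.
rewrite rcons_uniq => /andP[e0p _].
have aux x s : e0 \notin (belast x s) -> fpath g x s -> fpath ins (Some x) (map Some s).
  elim: s x => //= y s IHs x; rewrite inE negb_or => /andP[xe /IHs{}IHs] /andP[/eqP gx /IHs ->].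
  by rewrite andbT [x == e0]eq_sym (negPf xe) gx.
case: p e0p => [_|x p] /=; first by move/andP=> [/eqP-> _]; rewrite eqxx ?eqxx.
rewrite inE negb_or => /andP[xe ep].
rewrite !rcons_path !last_rcons /= => /andP[gp /eqP ge].
have := aux x (rcons p e0); rewrite belast_rcons inE negb_or xe ep => /(_ isT) aux1.
rewrite aux1 ?rcons_path ?gp ?ge ?eqxx //.
by rewrite map_rcons last_rcons /= !eqxx.
Qed.

End Insertion.

Lemma fconnect_omap (T : finType) (g : T -> T) u v :
  fconnect (omap g) u v =
  match u, v with
  | Some u, Some v => fconnect g u v
  | None, None => true
  | _, _ => false
  end.
Proof.
apply/idP/idP; last first.
  case: u v => [u|] [v|] //; case/connectP => p; elim: p u => [|w p IHp] u /=; first by move=> _ ->.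
  case/andP=> /eqP <- /IHp{}IHp /IHp; apply: connect_trans.
  exact: (fconnect1 (omap g) (Some u)).
case/connectP => p; elim: p u => [|w p IHp] [u|] /=; try by move=> _ ->.
- case/andP => /eqP <- /IHp{}IHp /IHp{IHp}; case: v => //= v; apply: connect_trans.
  exact: fconnect1.
- case/andP => /eqP <- /IHp{}IHp /IHp{IHp}; by case: v.
Qed.


Lemma half_add2 n : n.+2./2 = n./2 + 1.
Proof. by rewrite addn1. Qed.

Definition new_opp (T : Type) (f : T -> T) (u : option (option T)) :=
  match u with
  | None => Some None
  | Some None => None
  | Some (Some z) => Some (Some (f z))
  end.

Lemma new_oppK (T : Type) (f : T -> T) : involutive f -> involutive (new_opp f).
Proof. by move=> fK [[z|]|] //=; rewrite fK. Qed.

Lemma new_opp_neq (T : eqType) (f : T -> T) :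
  (forall e, f e != e) -> forall e, new_opp f e != e.
Proof. by move=> fN [[z|]|] //=; apply: contra (fN z) => /eqP[->]. Qed.

(* The new darts are None, from the final vertex of e to the new vertex, and its
   inverse Some None; they follow e on the boundary. *)
Section Spike.
Variables (D : planar_complex) (e : dart D).

Let next' : option (option (dart D)) -> _ := ins (ins (@next D) e) (Some e).
Let src' (u : option (option (dart D))) : option (vert D) :=
  match u with
  | None => Some (src (next e))
  | Some None => None
  | Some (Some z) => Some (src z)
  end.
Let face' (u : option (option (dart D))) : option (cell D) :=
  face (odflt e (odflt (Some e) u)).

Lemma spike_next_inj : injective next'.
Proof. by do 2 apply: ins_inj; exact: next_inj. Qed.

Lemma vertex_turn_inj (C : planar_complex) : injective (fun x : dart C => next (opp x)).
Proof. by move=> x y /next_inj /(can_inj (@oppK C)). Qed.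

Lemma spike_srcP u v :
  (src' u == src' v) = fconnect (fun x => next' (new_opp (@opp D) x)) u v.
Proof.
pose g := fun x : dart D => next (opp x).
(* Around vertices, [Some None] becomes a new fixed point, being the only dart at the new vertex;
   this is the [omap]. The dart [None] is spliced in after [opp e], at the final vertex of [e]. *)
have -> : fconnect (fun x => next' (new_opp (@opp D) x)) u v
          = fconnect (ins (omap g) (Some (opp e))) u v.
  apply: eq_fconnect => -[[z|]|] /=.
  - rewrite -[Some z == _]/(z == opp e) -[Some (opp z) == _]/(opp z == e).
    have -> : (opp z == e) = (z == opp e) by rewrite -(can_eq (@oppK D)) oppK.
    by case: (z == opp e).
  - by rewrite /next' /= eqxx.
  - by rewrite /g oppK.
rewrite fconnect_ins ?fconnect_omap; last first.
  by apply: inj_omap; exact: vertex_turn_inj.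
have eE : src (opp e) = src (next e).
  by apply/eqP; rewrite srcP; apply: connect1; rewrite /= oppK.
case: u v => [[u|]|] [[v|]|] //=; rewrite -?eE -?srcP ?eqxx //.
Qed.

Lemma spike_faceP u v : (face' u == face' v) = fconnect next' u v.
Proof.
rewrite /next' fconnect_ins; last by apply: ins_inj; exact: next_inj.
by rewrite fconnect_ins ?faceP //; exact: next_inj.
Qed.

Lemma spike_face_surj f : exists u, face' u = Some f.
Proof. by have [z zf] := face_surj f; exists (Some (Some z)). Qed.

Lemma spike_connP v w : connect (fun x y =>
  [exists u, (src' u == x) && (src' (new_opp (@opp D) u) == y)]) v w.
Proof.
set r := (fun x y => _).
have some x y : connect r (Some x) (Some y).
  case/connectP: (connP x y) => p; elim: p x => [|z p IHp] x /=; first by move=> _ ->.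
  case/andP=> /existsP[d /andP[/eqP dx /eqP dz]] /IHp{}IHp /IHp; apply: connect_trans.
  by apply: connect1; apply/existsP; exists (Some (Some d)); rewrite /= dx dz !eqxx.
have yx : connect r None (Some (src (next e))).
  by apply: connect1; apply/existsP; exists (Some None); rewrite /= !eqxx.
have xy : connect r (Some (src (next e))) None.
  by apply: connect1; apply/existsP; exists None; rewrite /= !eqxx.
case: v w => [v|] [w|] //.
- exact: connect_trans (some _ _) xy.
- exact: connect_trans yx (some _ _).
Qed.

Lemma spike_eulerP :
  #|{: option (vert D)}| + #|cell D| = #|{: option (option (dart D))}|./2 + 1.
Proof. by rewrite !card_option half_add2 addSn eulerP !addn1. Qed.

Definition spike : planar_complex :=
  PlanarComplex (new_oppK (@oppK D)) (new_opp_neq (@opp_neq D)) spike_next_inj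
    spike_srcP spike_faceP spike_face_surj spike_connP spike_eulerP.

Lemma spike_boundary_path (c : cell D) (p : seq (dart D)) :
  boundary_path (Some c) p -> face e = None ->
  @boundary_path spike (Some c) (map (Some \o Some) p).
Proof.
case=> pc pu pE fe.
have eN : e \notin p by rewrite pE inE fe.
split.
- rewrite map_comp; apply: fcycle_ins_notin; last exact: fcycle_ins_notin.
  by rewrite (mem_map Some_inj).
- by rewrite map_inj_uniq // => x y [].
- move=> u; apply/mapP/idP => [[x xp ->]|]; rewrite inE /=.
    by rewrite pE in xp.
  case: u => [[z|]|]; rewrite /face' /= ?fe // => zc; exists z => //; by rewrite pE.
Qed.

Lemma spike_outer_path (p : seq (dart D)) : boundary_path None (rcons p e) ->
  @boundary_path spike None (map (Some \o Some) (rcons p e) ++ [:: None; Some None]).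
Proof.
case=> pc pu pE; split.
- have := fcycle_ins pu pc; rewrite -cats1 cycle_catC cat1s map_rcons -rcons_cons => c1.
  have u1 : uniq (rcons (None :: [seq Some i | i <- p]) (Some e)).
    rewrite rcons_cons -map_rcons /= map_inj_uniq ?pu ?andbT; last by move=> x y [].
    by apply/negP=> /mapP[].
  have E : rcons (None :: [seq Some i | i <- p]) (Some e) = None :: map Some (rcons p e).
    by rewrite map_rcons.
  have := fcycle_ins u1 c1; rewrite {}E map_cons rcons_cons -cats1 -cat1s cycle_catC -catA.
  by rewrite -map_comp.
- rewrite cat_uniq map_inj_uniq ?pu; last by move=> x y [].
  apply/and3P; split=> //; apply/hasPn => u.
  by rewrite !inE => /orP[] /eqP ->; apply/negP=> /mapP[].
- have fe : face e = None.
    by have := pE e; rewrite mem_rcons mem_head inE => /esym/eqP.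
  move=> u; rewrite mem_cat !inE /= /face'.
  case: u => [[z|]|] /=; rewrite ?fe ?eqxx ?orbT ?orbF //.
  by rewrite (mem_map (f := Some \o Some)) ?pE // => x y [].
Qed.

Lemma ncells_spike j : ncells j spike <= (ncells j D).+1.
Proof.
case: j => -[|[|[|//]]] ? /=; rewrite /ncells /= ?card_option //.
Qed.

End Spike.


(* A new edge parallel to e1 :: p closes off a new 2-cell: None is its dart on
   the boundary of that cell and Some None its dart on the outer boundary. *)
Section Chord.
Variables (D : planar_complex) (e1 : dart D) (p v : seq (dart D)).
Hypothesis outer : boundary_path None ((e1 :: p) ++ v).

Let em := last e1 p.
Let el := last em v.
Let g := fun x : dart D => next (opp x).
Let E (z : dart D) : option (option (dart D)) := Some (Some z).
Let opp' := new_opp (@opp D).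
(** A chord creates no vertex, so here the turning permutation is obtained by splicing and [next']
    is derived from it; for a spike, which creates no face, [next'] itself is spliced. The nesting
    matters when [em = el]: [None] then precedes [Some None] around the vertex. *)
Let turn : option (option (dart D)) -> _ := ins (ins g (opp el)) (Some (opp em)).
Let next' u : option (option (dart D)) := turn (opp' u).
Let base (u : option (option (dart D))) : dart D :=
  odflt (opp el) (odflt (Some (opp em)) u).
Let src' u := src (base u).
Let face' (u : option (option (dart D))) : option (option (cell D)) :=
  match u with
  | None => Some None
  | Some None => None
  | Some (Some z) => if z \in e1 :: p then Some None else omap Some (face z)
  end.

Lemma turnE u : turn u = next' (opp' u).
Proof. by rewrite /next' /opp' (new_oppK (@oppK D)). Qed.

Lemma chord_next_inj : injective next'.
Proof.
apply: inj_comp; last exact: can_inj (new_oppK (@oppK D)).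
by do 2 apply: ins_inj; exact: (@vertex_turn_inj D).
Qed.

Lemma chord_srcP u w :
  (src' u == src' w) = fconnect (fun x => next' (opp' x)) u w.
Proof.
rewrite -(eq_fconnect turnE) /turn fconnect_ins; last exact: (ins_inj (@vertex_turn_inj D)).
by rewrite fconnect_ins ?srcP //; exact: (@vertex_turn_inj D).
Qed.

Let nextE z : next' (E z) = if z == em then None else
  if z == el then Some None else E (next z).
Proof.
rewrite /next' /opp' /E /=.
rewrite -[Some (opp z) == _]/(opp z == opp em) !(can_eq (@oppK D)).
by case: (z == em); case: (z == el); rewrite /g ?oppK.
Qed.

Let outerE z : (face z == None) = (z \in (e1 :: p) ++ v).
Proof. by case: outer => _ _ ->. Qed.

Let pv_disj z : z \in v -> z \notin e1 :: p.
Proof.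
case: outer => _; rewrite cat_uniq => /and3P[_ /hasPn h _] _; exact: h.
Qed.

Let el_in : el \in (e1 :: p) ++ v.
Proof. by rewrite mem_cat /el /em; case: v => [|f1 v'] /=; rewrite mem_last ?orbT. Qed.

Let em_in : em \in e1 :: p.
Proof. exact: mem_last. Qed.

Let next_el : next el = e1.
Proof.
case: outer => + _ _; rewrite /el /em /= rcons_path last_cat => /andP[_ /eqP] //.
Qed.

Let nextNone : next' None = E e1.
Proof. by rewrite /next' /turn /= /g oppK next_el. Qed.

Let nextSN : next' (Some None) = if em == el then Some None else E (next em).
Proof.
by rewrite /next' /turn /= (can_eq (@oppK D)); case: (em == el); rewrite /g ?oppK.
Qed.

Let fpath_chord x s : fpath (@next D) x s ->
  em \notin belast x s -> el \notin belast x s -> fpath next' (E x) (map E s).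
Proof.
elim: s x => //= y s IHs x /andP[/eqP xy /IHs{}IHs].
rewrite !inE !negb_or => /andP[xm ms] /andP[xl ls].
by rewrite IHs // nextE (eq_sym x em) (negPf xm) (eq_sym x el) (negPf xl) xy eqxx.
Qed.

Let last_belast (x : dart D) s : uniq (x :: s) -> last x s \notin belast x s.
Proof. by rewrite lastI rcons_uniq => /andP[]. Qed.

Let elP : el = em \/ el \in v.
Proof. by have := mem_last em v; rewrite inE => /predU1P. Qed.

Lemma chord_inner_cycle : fcycle next' (rcons (map E (e1 :: p)) None).
Proof.
case: outer => oc ou _.
rewrite map_cons rcons_cons /= !rcons_path last_rcons /= nextNone eqxx andbT.
rewrite last_map nextE eqxx eqxx andbT.
have up : uniq (e1 :: p) by move: ou; rewrite cat_uniq => /andP[].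
apply: fpath_chord.
- by move: oc; rewrite /= rcons_cat cat_path => /andP[].
- exact: last_belast.
- have [->|elv] := elP; first exact: last_belast.
  by apply: contra (pv_disj elv) => /mem_belast.
Qed.

Lemma chord_outer_cycle : fcycle next' (Some None :: map E v).
Proof.
case: outer => oc ou _.
have [v0|[f1 [v' vE]]] : v = [::] \/ exists f1 v', v = f1 :: v'.
- by case: (v) => [|f1 v']; [left|right; exists f1, v'].
- by rewrite v0 /= nextSN /el v0 eqxx eqxx.
have elE : el = last f1 v' by rewrite /el vE.
have elv : el \in v by rewrite elE vE mem_last.
have ne : em == el = false.
  by apply: contraNF (pv_disj elv) => /eqP <-.
move: oc; rewrite /= rcons_path cat_path => /andP[/andP[_ +] _].
rewrite vE /= -/em => /andP[/eqP fE f1p].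
rewrite nextSN ne fE eqxx /= rcons_path last_map -elE /= nextE (eq_sym el) ne !eqxx andbT.
apply: fpath_chord => //.
- apply/negP => /mem_belast emv.
  by have := pv_disj (z := em); rewrite vE emv em_in => /(_ isT).
- rewrite elE; apply: last_belast.
  by move: ou; rewrite cat_uniq vE => /and3P[].
Qed.

Let E_inj : injective E. Proof. by move=> x y []. Qed.

Let memE z s : (Some (Some z) \in map E s) = (z \in s).
Proof. exact: (mem_map E_inj). Qed.

Lemma chord_face_inner u : (face' u == Some None) = (u \in rcons (map E (e1 :: p)) None).
Proof.
rewrite mem_rcons [RHS]inE; case: u => [[z|]|] //.
- rewrite memE /=; case: ifP => //= _; by case: (face z).
- by apply/esym/negbTE/mapP => -[].
Qed.

Lemma chord_face_outer u : (face' u == None) = (u \in Some None :: map E v).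
Proof.
rewrite inE; case: u => [[z|]|] //.
- rewrite memE /=; case: ifP => zp /=.
    by apply/esym/negbTE; apply: contraL zp => /pv_disj.
  have := outerE z; rewrite mem_cat zp /= => <-.
  by case: (face z).
- by apply/esym/negbTE/mapP => -[].
Qed.

(** Only [em] and [el] get a new successor, and both lie on the outer face. The old outer orbit thus
    splits into the two explicit cycles, and every other orbit of [next] survives unchanged. *)
Lemma chord_faceP u w : (face' u == face' w) = fconnect next' u w.
Proof.
case uI: (u \in rcons (map E (e1 :: p)) None).
  rewrite (fconnect_cycle chord_inner_cycle uI) -chord_face_inner.
  by move: uI; rewrite -chord_face_inner eq_sym => /eqP ->.
case uO: (u \in Some None :: map E v).
  rewrite (fconnect_cycle chord_outer_cycle uO) -chord_face_outer.
  by move: uO; rewrite -chord_face_outer eq_sym => /eqP ->.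
have [z uz] : exists z, u = E z.
  case: u uI uO => [[z|]|]; first by exists z.
    by rewrite mem_head.
  by rewrite mem_rcons mem_head.
move: uI uO; rewrite uz mem_rcons !in_cons [E z \in map E p]memE [E z \in map E v]memE.
rewrite -[E z == E e1]/(z == e1) -in_cons /= => zp zv.
have zpv : z \notin (e1 :: p) ++ v by rewrite mem_cat zp zv.
have fz : face z != None by rewrite outerE.
have c : fcycle next' (map E (orbit (@next D) z)).
  apply: (homo_cycle_in (P := [in orbit (@next D) z])) (cycle_orbit (@next_inj D) z);
    last exact/allP.
  move=> x y; rewrite -!fconnect_orbit -!faceP => /eqP xz _ /= /eqP <-; rewrite nextE.
  have xpv : x \notin (e1 :: p) ++ v by rewrite -outerE -xz.
  case: (x =P em) => [xe|_]; first by rewrite xe mem_cat em_in in xpv.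
  by case: (x =P el) => [xe|_ //]; rewrite xe el_in in xpv.
rewrite (fconnect_cycle c); last by rewrite memE -fconnect_orbit connect0.
rewrite /= zp; case: w => [[w|]|] /=.
- rewrite memE -fconnect_orbit -faceP; case: ifP => wp.
    have /eqP -> : face w == None by rewrite outerE mem_cat wp.
    by case: (face z) fz.
  by case: (face z); case: (face w).
- by case: (face z) fz => // ? _; apply/esym/negbTE/mapP => -[].
- by case: (face z) fz => // ? _; apply/esym/negbTE/mapP => -[].
Qed.

Lemma chord_face_surj f : exists u, face' u = Some f.
Proof.
case: f => [f|]; last by exists None.
have [z zf] := face_surj f; exists (E z); rewrite /= zf.
case: ifP => // zp; have := outerE z; by rewrite zf mem_cat zp.
Qed.

Lemma chord_connP x y : connect (fun x y =>
  [exists u, (src' u == x) && (src' (opp' u) == y)]) x y.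
Proof.
apply: connect_sub (connP x y) => a b /existsP[d dab]; apply: connect1.
by apply/existsP; exists (E d).
Qed.

Lemma chord_eulerP :
  #|vert D| + #|{: option (cell D)}| = #|{: option (option (dart D))}|./2 + 1.
Proof. by rewrite !card_option half_add2 addnS eulerP !addn1. Qed.

Definition chord : planar_complex :=
  PlanarComplex (new_oppK (@oppK D)) (new_opp_neq (@opp_neq D)) chord_next_inj
    chord_srcP chord_faceP chord_face_surj chord_connP chord_eulerP.

Lemma chord_boundary_path (c : cell D) (q : seq (dart D)) :
  boundary_path (Some c) q -> @boundary_path chord (Some (Some c)) (map E q).
Proof.
case=> qc qu qE.
have qpv x : x \in q -> x \notin (e1 :: p) ++ v.
  by rewrite qE inE -outerE => /eqP ->.
split.
- apply: (homo_cycle_in (P := [in q])) qc; last exact/allP.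
  move=> x y /qpv xpv _ /= /eqP <-; rewrite nextE.
  case: (x =P em) => [xe|_]; first by rewrite xe mem_cat em_in in xpv.
  by case: (x =P el) => [xe|_ //]; rewrite xe el_in in xpv.
- by rewrite map_inj_uniq.
- move=> u; rewrite inE /=; case: u => [[z|]|] /=.
  + rewrite memE qE inE; case: ifP => zp.
      have /eqP -> // : face z == None by rewrite outerE mem_cat zp.
    by case: (face z).
  + by apply/negbTE/mapP => -[].
  + by apply/negbTE/mapP => -[].
Qed.

Lemma chord_inner_path : @boundary_path chord (Some None) (rcons (map E (e1 :: p)) None).
Proof.
case: outer => _ ou _; split; first exact: chord_inner_cycle.
- rewrite rcons_uniq map_inj_uniq //; apply/andP; split; first by apply/mapP => -[].
  by move: ou; rewrite cat_uniq => /andP[].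
- by move=> u; rewrite -chord_face_inner.
Qed.

Lemma chord_outer_path : @boundary_path chord None (Some None :: map E v).
Proof.
case: outer => _ ou _; split; first exact: chord_outer_cycle.
- rewrite cons_uniq map_inj_uniq //; apply/andP; split; first by apply/mapP => -[].
  by move: ou; rewrite cat_uniq => /and3P[].
- by move=> u; rewrite -chord_face_outer.
Qed.

Lemma ncells_chord j : ncells j chord <= (ncells j D).+1.
Proof.
by case: j => -[|[|[|//]]] ? /=; rewrite /ncells /= ?card_option.
Qed.

End Chord.


Definition point_complex : planar_complex.
Proof.
refine (@PlanarComplex unit void void id id (fun=> tt) (fun=> None)
  _ _ _ _ _ _ _ _) => //; try by case.
- by case=> [] []; exact: connect0.
- by rewrite card_unit card_void.
Defined.

(** A spike has to follow an existing dart, and the one-vertex complex has none; this is what its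
    spike would be. *)
Definition edge_complex : planar_complex.
Proof.
refine (@PlanarComplex bool bool void negb negb id (fun=> None)
  _ _ _ _ _ _ _ _) => //; try by case.
- exact: inv_inj negbK.
- move=> u v; rewrite (eq_fconnect (f' := id)) ?fconnect_id; last exact: negbK.
  by rewrite eq_sym.
- have nb b : fconnect negb b (~~ b) by exact: fconnect1.
  by case=> [] []; rewrite eqxx ?connect0 //; [have := nb true|have := nb false] => ->.
- set r := (fun x y => _).
  have nb b : connect r b (~~ b) by apply: connect1; apply/existsP; exists b; rewrite !eqxx.
  by case=> [] []; rewrite ?connect0 //.
- by rewrite card_bool card_void.
Defined.

(** * Spikes and 2-cells on labelled diagrams *)

Section Diagrams.
Variables (A : finType) (P : presentation A).
Implicit Types (u v w : word A) (l : A * bool).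

Lemma linvK l : linv (linv l) = l.
Proof. by case: l => a b; rewrite /linv /= negbK. Qed.

Lemma boundary_path_rot (D : planar_complex) (c : option (cell D)) p i :
  boundary_path c p -> boundary_path c (rot i p).
Proof.
by case=> pc pu pE; split; rewrite ?rot_cycle ?rot_uniq // => x; rewrite mem_rot.
Qed.

Definition has_diagram w n : Prop :=
  exists D : van_kampen_diagram P, boundary_label D w /\ forall j, ncells j D <= n.

Definition cyclic_relator w : Prop :=
  exists i r, r \in relators P /\ (rot i w = r \/ rot i w = winv r).

Lemma has_diagram_rot u v n : has_diagram (u ++ v) n -> has_diagram (v ++ u) n.
Proof.
case=> D [[p [pD pE]] Dn]; exists D; split=> //.
exists (rot (size u) p); split; first exact: boundary_path_rot.
by rewrite map_rot pE rot_size_cat.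
Qed.

Lemma has_diagram_nil : has_diagram [::] 1.
Proof.
pose lab (e : dart point_complex) : A * bool := match (e : void) with end.
have lo e : lab (opp e) = linv (lab e) by case: e.
have lc (f : cell point_complex) : exists p r, [/\ boundary_path (Some f) p,
    r \in relators P & map lab p = r \/ map lab p = winv r] by case: f.
exists (VanKampen lo lc); split; first by exists [::]; split=> //; split=> // -[].
by case=> -[|[|[|//]]] ?; rewrite /ncells /= ?card_unit ?card_void.
Qed.

Lemma has_diagram_edge l : has_diagram [:: l; linv l] 2.
Proof.
pose lab (e : dart edge_complex) := if e then linv l else l.
have lo e : lab (opp e) = linv (lab e) by case: e => //=; rewrite linvK.
have lc (f : cell edge_complex) : exists p r, [/\ boundary_path (Some f) p,
    r \in relators P & map lab p = r \/ map lab p = winv r] by case: f.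
exists (VanKampen lo lc); split.
  by exists [:: false; true]; split=> //; split=> // -[].
by case=> -[|[|[|//]]] ?; rewrite /ncells /= ?card_bool ?card_void.
Qed.

Lemma has_diagram_spike w l n :
  has_diagram w n.+1 -> has_diagram (w ++ [:: l; linv l]) n.+2.
Proof.
case=> D [[p [pD <-]] Dn]; case: (lastP p) pD => [_|q e pD].
  have [D' [lD' D'n]] := has_diagram_edge l; exists D'; split=> // j.
  by apply: leq_trans (D'n j) _.
have fe : face e = None.
  by have [_ _ /(_ e)] := pD; rewrite mem_rcons mem_head inE => /esym/eqP.
pose lab (u : dart (spike e)) := match u with
  | None => l | Some None => linv l | Some (Some z) => label z end.
have lo (u : dart (spike e)) : lab (opp u) = linv (lab u).
  by case: u => [[z|]|] //=; rewrite ?label_opp ?linvK.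
have lc (f : cell (spike e)) : exists p r, [/\ boundary_path (Some f) p,
    r \in relators P & map lab p = r \/ map lab p = winv r].
  have [q' [r [qb rP qr]]] := label_cell (v := D) f.
  exists (map (Some \o Some) q'), r; split=> //; first exact: spike_boundary_path.
  by rewrite -map_comp (eq_map (g := label (v := D))).
exists (VanKampen lo lc); split; last first.
  by move=> j; apply: leq_trans (ncells_spike e j) _; rewrite ltnS.
exists (map (Some \o Some) (rcons q e) ++ [:: None; Some None]); split.
  exact: spike_outer_path.
by rewrite map_cat -map_comp (eq_map (g := label (v := D))).
Qed.

(** The new edge, labelled [l] on the outside, runs parallel to [p]; the new cell reads [p] followed
    by the inner dart, labelled [linv l]. *)
Lemma has_diagram_chord p v l n : p != [::] -> cyclic_relator (rcons p (linv l)) ->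
  has_diagram (p ++ v) n -> has_diagram (l :: v) n.+1.
Proof.
move=> p0 [i [r [rP ir]]] [D [[s [sD sE]] Dn]].
have sizes : size p <= size s by rewrite -(size_map (label (v := D))) sE size_cat leq_addr.
have [s1 [s2 [s12 s1p s2v]]] : exists s1 s2, [/\ s = s1 ++ s2,
    map (label (v := D)) s1 = p & map (label (v := D)) s2 = v].
  exists (take (size p) s), (drop (size p) s).
  by rewrite cat_take_drop map_take map_drop sE take_size_cat ?drop_size_cat.
case: s1 s12 s1p => [_ /= p0'|e1 s1 s12 s1p]; first by rewrite -p0' in p0.
rewrite s12 in sD.
pose lab (u : dart (chord sD)) := match u with
  | None => linv l | Some None => l | Some (Some z) => label z end.
have lo (u : dart (chord sD)) : lab (opp u) = linv (lab u).
  by case: u => [[z|]|] //=; rewrite ?label_opp ?linvK.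
have labE (q : seq (dart D)) : map lab (map (Some \o Some) q) = map (label (v := D)) q.
  by rewrite -map_comp.
have lc (f : cell (chord sD)) : exists p r, [/\ boundary_path (Some f) p,
    r \in relators P & map lab p = r \/ map lab p = winv r].
  case: f => [f|].
    have [q [r' [qb rP' qr]]] := label_cell (v := D) f.
    exists (map (Some \o Some) q), r'; split=> //; last by rewrite labE.
    exact: chord_boundary_path.
  exists (rot i (rcons (map (Some \o Some) (e1 :: s1)) None)), r; split=> //.
    by apply: boundary_path_rot; exact: chord_inner_path.
  by rewrite map_rot map_rcons labE s1p.
exists (VanKampen lo lc); split; last first.
  by move=> j; apply: leq_trans (ncells_chord sD j) _; rewrite ltnS.
exists (Some None :: map (Some \o Some) s2); split; first exact: chord_outer_path.
by rewrite -s2v /= labE.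
Qed.

End Diagrams.

(** * Diagrams from derivations *)


(** Derivations are found case by case without counting their steps; over a finite set of cases this
    yields one constant for all of them. *)
Lemma bounded_choice (T : eqType) (s : seq T) (Q : nat -> T -> Prop) :
  (forall m n x, m <= n -> Q m x -> Q n x) ->
  (forall x, x \in s -> exists n, Q n x) -> exists n, forall x, x \in s -> Q n x.
Proof.
move=> Qmono; elim: s => [_|y s IHs sQ]; first by exists 0.
have [n nP] := IHs (fun x xs => sQ x (mem_behead (s := y :: s) xs)).
have [m mP] := sQ y (mem_head _ _).
exists (maxn m n) => x; rewrite inE => /predU1P[->|/nP].
  exact: Qmono (leq_maxl _ _) mP.
exact: Qmono (leq_maxr _ _).
Qed.

Section Derivations.
Variables (A : finType) (P : presentation A).
Implicit Types (u v w : word A) (l : A * bool).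

Lemma winv_cat u v : winv (u ++ v) = winv v ++ winv u.
Proof. by rewrite /winv map_cat rev_cat. Qed.

Lemma winvK u : winv (winv u) = u.
Proof.
by rewrite /winv map_rev revK -map_comp (eq_map (g := id)) ?map_id // => l; exact: linvK.
Qed.

Lemma winv_cons l u : winv (l :: u) = winv u ++ [:: linv l].
Proof. by rewrite -cat1s winv_cat. Qed.

Lemma size_winv u : size (winv u) = size u.
Proof. by rewrite /winv size_rev size_map. Qed.

Lemma winv_rot i u : winv (rot i u) = rotr i (winv u).
Proof. by rewrite /winv map_rot rev_rot. Qed.

Lemma cyclic_relator_rot u v : cyclic_relator P (u ++ v) -> cyclic_relator P (v ++ u).
Proof.
rewrite -[u ++ v](rot_size_cat v u) => -[i [r]]; rewrite rot_rot_add => ir.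
by exists (rot_add (v ++ u) (size v) i), r.
Qed.

Lemma cyclic_relator_winv w : cyclic_relator P w -> cyclic_relator P (winv w).
Proof.
case=> i [r [rP ir]]; exists (size (winv w) - i), r; split=> //.
rewrite -/(rotr i (winv w)) -winv_rot.
by case: ir => ->; [right|left; rewrite winvK].
Qed.

Lemma cyclic_relator_id r : r \in relators P -> cyclic_relator P r.
Proof. by move=> rP; exists 0, r; rewrite rot0; split; last by left. Qed.

Lemma has_diagram_le m n w : m <= n -> has_diagram P w m -> has_diagram P w n.
Proof.
by move=> mn [D [Dw Dm]]; exists D; split=> // j; exact: leq_trans (Dm j) mn.
Qed.

(* The steps that can be undone on diagrams by adding a spike or a 2-cell in the
   outer region.  A relator may not be inserted at an empty place, since undoing
   this would identify two vertices of the boundary. *)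
Inductive gstep : word A -> word A -> Prop :=
| GDel u l v : gstep (u ++ [:: l; linv l] ++ v) (u ++ v)
| GRel u x s t v : cyclic_relator P ((x :: s) ++ winv t) ->
    gstep (u ++ (x :: s) ++ v) (u ++ t ++ v).

Inductive gder : nat -> word A -> word A -> Prop :=
| GDer0 n u : gder n u u
| GDerS n u v w : gstep u v -> gder n v w -> gder n.+1 u w.

Lemma gstep_ctx p s u v : gstep u v -> gstep (p ++ u ++ s) (p ++ v ++ s).
Proof.
case=> [u' l v'|u' x t t' v' c].
  by rewrite -!catA !(catA p u'); exact: GDel.
by rewrite -!catA !(catA p u'); exact: GRel.
Qed.

Lemma gder_ctx p s n u v : gder n u v -> gder n (p ++ u ++ s) (p ++ v ++ s).
Proof.
elim=> [m w|m w w' w'' /(gstep_ctx p s) st _ IH]; first exact: GDer0.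
exact: GDerS st IH.
Qed.

Lemma gder_le m n u v : m <= n -> gder m u v -> gder n u v.
Proof.
move=> + uv; elim: uv n => [k w|k w w' w'' st _ IH] [|n] //; try by move=> _; exact: GDer0.
by rewrite ltnS => /IH; exact: GDerS.
Qed.

Lemma gder_trans m n u v w : gder m u v -> gder n v w -> gder (m + n) u w.
Proof.
move=> uv; elim: uv w => [k t|k t t' t'' st _ IH] w vw.
  by apply: gder_le vw; rewrite leq_addl.
by rewrite addSn; exact: GDerS st (IH _ vw).
Qed.

Lemma gder1 u v : gstep u v -> gder 1 u v.
Proof. by move=> uv; apply: GDerS uv _; exact: GDer0. Qed.

(** Write [x :: s] as [rcons r l]. The relator equates [winv r ++ t] with [l]: spikes draw [r] and
    its inverse in front of [t], and one chord replaces [winv r ++ t] by [l]. That path is nonempty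
    because no relator has length 1. *)
Lemma has_diagram_attach x s t v n : all (fun r : word A => 1 < size r) (relators P) ->
  cyclic_relator P ((x :: s) ++ winv t) ->
  has_diagram P (t ++ v) n.+1 -> has_diagram P ((x :: s) ++ v) (n + (size s).+1).+1.
Proof.
move=> /allP P1 c Dt; have : size (x :: s) = (size s).+1 by [].
move: (x :: s) c => q; case/lastP: q => // r l c; rewrite size_rcons => -[<-].
have size_c w : cyclic_relator P w -> 1 < size w.
  case=> i [q [qP iq]]; have := P1 _ qP.
  by case: iq => iq; rewrite -(size_rot i w) iq ?size_winv.
have spikes q : has_diagram P (winv q ++ t ++ v ++ q) (n + size q).+1.
  elim/last_ind: q => [|q y IHq]; first by rewrite cats0 addn0.
  rewrite size_rcons addnS -cats1 winv_cat -catA.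
  apply: (has_diagram_rot (u := winv q ++ t ++ v ++ q ++ [:: y]) (v := [:: linv y])).
  by move/(has_diagram_spike y): IHq; rewrite -!catA.
rewrite addnS -addSn -cats1 -catA.
apply: (@has_diagram_rot _ _ ([:: l] ++ v)); rewrite -catA.
apply: (@has_diagram_chord _ _ (winv r ++ t)); last by rewrite -catA; exact: spikes.
- have := size_c _ c; rewrite size_cat size_rcons size_winv -size_eq0 size_cat size_winv.
  by case: (size r); case: (size t).
- move/cyclic_relator_winv: c; rewrite winv_cat winvK -cats1 winv_cat -cats1 => c.
  by have := cyclic_relator_rot (u := t ++ [:: linv l]) (v := winv r); rewrite -!catA; apply.
Qed.

Lemma has_diagram_gder : all (fun r : word A => 1 < size r) (relators P) ->
  exists K, forall n u v m, gder n u v -> has_diagram P v m.+1 ->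
    has_diagram P u (m + n * K).+1.
Proof.
move=> P1; pose K := (\max_(r <- relators P) size r).+1.
have size_c w : cyclic_relator P w -> size w < K.
  case=> i [q [qP iq]]; rewrite ltnS -(size_rot i w).
  have -> : size (rot i w) = size q by case: iq => ->; rewrite ?size_winv.
  exact: (@leq_bigmax_seq _ _ _ (fun r : word A => size r) q qP).
exists K => n u v m uv; elim: uv m => [k w|k w w' w'' st _ IH] m Dv.
  by apply: has_diagram_le Dv; rewrite ltnS leq_addr.
have {IH Dv} := IH m Dv; case: st => [p l q|p x s t q c] D.
  apply: (@has_diagram_le (m + k * K).+2); first by rewrite mulSn /K; lia.
  rewrite catA; apply: has_diagram_rot; rewrite catA.
  by apply: has_diagram_spike; exact: has_diagram_rot.
apply: (@has_diagram_le (m + k * K + (size s).+1).+1).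
  by have := size_c _ c; rewrite size_cat /= mulSn; lia.
apply: (@has_diagram_rot _ _ ((x :: s) ++ q)); rewrite -catA.
apply: has_diagram_attach c _ => //; rewrite catA.
exact: has_diagram_rot.
Qed.

End Derivations.


(** * From unrestricted derivations to diagrams *)

Section Area.
Variables (A : finType) (P : presentation A).
Implicit Types (u v w : word A) (l : A * bool).

Inductive astep : word A -> word A -> Prop :=
| AFree u l v : astep (u ++ [:: l; linv l] ++ v) (u ++ v)
| ARel u r v : r \in relators P -> astep (u ++ r ++ v) (u ++ v).

(** Steps may be taken in both directions and at any place: the group theory is done in this
    calculus, while only [gder] acts on diagrams. *)
Inductive ar : nat -> word A -> word A -> Prop :=
| Ar0 n u : ar n u u
| ArS n u v w : astep u v \/ astep v u -> ar n v w -> ar n.+1 u w.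

Lemma ar_le m n u v : m <= n -> ar m u v -> ar n u v.
Proof.
move=> + uv; elim: uv n => [k w|k w w' w'' st _ IH] [|n] //; try by move=> _; exact: Ar0.
by rewrite ltnS => /IH; exact: ArS.
Qed.

Lemma ar_trans m n u v w : ar m u v -> ar n v w -> ar (m + n) u w.
Proof.
move=> uv; elim: uv w => [k t|k t t' t'' st _ IH] w vw.
  by apply: ar_le vw; rewrite leq_addl.
by rewrite addSn; exact: ArS st (IH _ vw).
Qed.

Lemma ar_sym n u v : ar n u v -> ar n v u.
Proof.
elim=> [k w|k w w' w'' st _ IH]; first exact: Ar0.
rewrite -addn1; apply: ar_trans IH _; apply: ArS (Ar0 _ _); tauto.
Qed.

Lemma ar_ctx p s n u v : ar n u v -> ar n (p ++ u ++ s) (p ++ v ++ s).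
Proof.
have ctx u' v' : astep u' v' -> astep (p ++ u' ++ s) (p ++ v' ++ s).
  case=> [a l b|a r b rP]; rewrite -!catA !(catA p a); first exact: AFree.
  exact: ARel.
elim=> [k w|k w w' w'' st _ IH]; first exact: Ar0.
by apply: ArS IH; case: st => /ctx; [left|right].
Qed.

Lemma ar_cat m n u v u' v' : ar m u u' -> ar n v v' -> ar (m + n) (u ++ v) (u' ++ v').
Proof.
move=> /(ar_ctx [::] v) /= uu /(ar_ctx u' [::]); rewrite !cats0; exact: ar_trans.
Qed.

Lemma ar_cancel p l s : ar 1 (p ++ [:: l; linv l] ++ s) (p ++ s).
Proof. by apply: ArS (Ar0 _ _); left; exact: AFree. Qed.

Lemma ar_relator p r s : r \in relators P -> ar 1 (p ++ r ++ s) (p ++ s).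
Proof. by move=> rP; apply: ArS (Ar0 _ _); left; exact: ARel. Qed.

Definition eqv u v := exists n, ar n u v.

Lemma eqv_refl u : eqv u u.
Proof. by exists 0; exact: Ar0. Qed.

Lemma eqv_sym u v : eqv u v -> eqv v u.
Proof. by case=> n; exists n; exact: ar_sym. Qed.

Lemma eqv_trans v u w : eqv u v -> eqv v w -> eqv u w.
Proof. by move=> [m uv] [n vw]; exists (m + n); exact: ar_trans uv vw. Qed.

Lemma eqv_cat u v u' v' : eqv u u' -> eqv v v' -> eqv (u ++ v) (u' ++ v').
Proof. by move=> [m uv] [n vw]; exists (m + n); exact: ar_cat. Qed.

Lemma eqv_ctx p s u v : eqv u v -> eqv (p ++ u ++ s) (p ++ v ++ s).
Proof. by case=> n uv; exists n; exact: ar_ctx. Qed.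

Lemma eqv_catV u : eqv (u ++ winv u) [::].
Proof.
elim: u => [|l u IHu]; first exact: eqv_refl.
rewrite winv_cons; apply: (@eqv_trans ([:: l] ++ [::] ++ [:: linv l])).
  rewrite -[(l :: u) ++ _]/([:: l] ++ u ++ winv u ++ [:: linv l]) (catA u).
  exact: eqv_ctx.
by exists 1; exact: (ar_cancel [::] l [::]).
Qed.

Lemma eqv_Vcat u : eqv (winv u ++ u) [::].
Proof. by rewrite -{2}[u]winvK; exact: eqv_catV. Qed.

Lemma in_ncl_eqv w : in_ncl P w -> eqv w [::].
Proof.
elim=> {w}[r rP||u v _ IHu _ IHv|u _ IHu|g u _ IHu|u v uv _ IHu].
- by exists 1; have := ar_relator [::] [::] rP; rewrite cats0.
- exact: eqv_refl.
- exact: (eqv_cat IHu IHv).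
- apply: eqv_trans (eqv_Vcat u); rewrite -{1}[winv u]cats0.
  by apply: eqv_cat (eqv_sym IHu); exact: eqv_refl.
- by apply: eqv_trans (eqv_catV g); exact: (eqv_ctx g (winv g) IHu).
- apply: eqv_trans IHu; elim: uv => [a b l|a|a b _|a b c _ + _ +].
  + by apply: eqv_sym; exists 1; exact: ar_cancel.
  + exact: eqv_refl.
  + exact: eqv_sym.
  + by move=> bc ab; exact: eqv_trans ab bc.
Qed.

Definition gex u v := exists n, gder P n u v.

Lemma gex_trans v u w : gex u v -> gex v w -> gex u w.
Proof. by move=> [m uv] [n vw]; exists (m + n); exact: gder_trans uv vw. Qed.

Lemma gex_ctx p s u v : gex u v -> gex (p ++ u ++ s) (p ++ v ++ s).
Proof. by case=> n uv; exists n; exact: gder_ctx. Qed.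

Lemma gex1 u v : gstep P u v -> gex u v.
Proof. by exists 1; exact: gder1. Qed.

Definition insertable x l := gex [:: x] [:: x; l; linv l].

(** The relator turns [x] into s^-1 l^-1, and read again it turns s^-1 into x l, which leaves x l
    l^-1. Both replaced words are nonempty, as [GRel] demands. *)
Lemma insertable_turn x l s : s != [::] -> cyclic_relator P (x :: l :: s) -> insertable x l.
Proof.
move=> s0 c; apply: (@gex_trans (winv (l :: s))).
  have := @GRel _ P [::] x [::] (winv (l :: s)) [::].
  by rewrite winvK !cats0 => /(_ c); exact: gex1.
have s'0 : winv s != [::] by rewrite -size_eq0 size_winv size_eq0.
case sE: (winv s) s'0 => [//|y t] _.
rewrite winv_cons sE.
apply/gex1/(@GRel _ P [::] y t [:: x; l] [:: linv l]).
by rewrite -sE -winv_cat; exact: cyclic_relator_winv.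
Qed.

Lemma insertable_trans x l m : insertable x l -> insertable (linv l) m -> insertable x m.
Proof.
move=> xl lm; apply: gex_trans xl _.
apply: (@gex_trans [:: x; l; linv l; m; linv m]).
  exact: (gex_ctx [:: x; l] [::] lm).
exact/gex1/(@GDel _ P [:: x] l [:: m; linv m]).
Qed.

Hypothesis insertableP : forall x l, insertable x l.

Lemma gex_insert p l s : p != [::] -> gex (p ++ s) (p ++ [:: l; linv l] ++ s).
Proof.
case: (lastP p) => // q x _; rewrite -cats1 -!catA.
exact: (gex_ctx q s (insertableP x l)).
Qed.

Lemma gex_insert_word p u : p != [::] -> gex p (p ++ u ++ winv u).
Proof.
elim: u p => [|l u IHu] p p0; first by rewrite cats0; exists 0; exact: GDer0.
apply: (@gex_trans (p ++ [:: l; linv l])).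
  by have := gex_insert l [::] p0; rewrite !cats0.
rewrite winv_cons -[p ++ [:: l; linv l]]/(p ++ [:: l] ++ [:: linv l]) catA.
have pl0 : p ++ [:: l] != [::] by case: (p).
have := gex_ctx [::] [:: linv l] (IHu _ pl0).
by rewrite /= -!catA.
Qed.

Lemma gstep_relator p r s : r \in relators P -> gstep P (p ++ r ++ s) (p ++ s).
Proof.
move=> rP; have : r != [::] by have /allP/(_ _ rP)/andP[] := relatorsP P.
case rE: r => [//|x t] _; apply: (@GRel _ P p x t [::] s).
by rewrite cats0 -rE; exact: cyclic_relator_id.
Qed.

Lemma gstep_winv_relator p r s : r \in relators P -> gstep P (p ++ winv r ++ s) (p ++ s).
Proof.
move=> rP; have : winv r != [::].
  by have /allP/(_ _ rP)/andP[] := relatorsP P; rewrite -!size_eq0 size_winv.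
case rE: (winv r) => [//|x t] _; apply: (@GRel _ P p x t [::] s).
by rewrite cats0 -rE; exact/cyclic_relator_winv/cyclic_relator_id.
Qed.

Lemma gex_insert_relator p r s : p != [::] -> r \in relators P ->
  gex (p ++ s) (p ++ r ++ s).
Proof.
move=> p0 rP; apply: (@gex_trans (p ++ r ++ winv r ++ s)).
  have := gex_ctx [::] s (gex_insert_word r p0); by rewrite /= -!catA.
by apply: gex1; rewrite !(catA p r); exact: gstep_winv_relator.
Qed.

(** The leading letter makes every prefix nonempty, so an insertion depends only on the last letter
    of the prefix and on what is inserted: finitely many cases. *)
Lemma gder_astep : exists K, forall y u v, astep u v \/ astep v u ->
  gder P K (y :: u) (y :: v).
Proof.
have [K1 K1P] : exists K1, forall yl : (A * bool) * (A * bool), yl \in enum predT ->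
    gder P K1 [:: yl.1] [:: yl.1, yl.2, linv yl.2 & [::]].
  apply: bounded_choice => [m n yl mn|yl _]; first exact: gder_le.
  exact: insertableP.
have [K2 K2P] : exists K2, forall yr : (A * bool) * word A,
    yr \in [seq (y, r) | y <- enum {: A * bool}, r <- relators P] ->
    gder P K2 [:: yr.1] (yr.1 :: yr.2).
  apply: bounded_choice => [m n yr mn|yr]; first exact: gder_le.
  case/allpairsP=> -[y r] /= [_ rP ->] /=.
  by have := gex_insert_relator (p := [:: y]) [::] isT rP; rewrite !cats0.
exists (maxn 1 (maxn K1 K2)) => y u v; case; case => [p l s|p r s rP].
- apply: (@gder_le _ _ 1); first by rewrite leq_max leqnn.
  by apply: gder1; exact: (@GDel _ P (y :: p)).
- apply: (@gder_le _ _ 1); first by rewrite leq_max leqnn.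
  by apply: gder1; exact: (@gstep_relator (y :: p)).
- apply: (@gder_le _ _ K1); first by rewrite !leq_max leqnn !orbT.
  rewrite -!(cat_cons y p).
  case/lastP: (y :: p) (isT : y :: p != [::]) => // q z _; rewrite -cats1 -!catA.
  by apply: (gder_ctx q s (K1P (z, l) _)); rewrite mem_enum.
- apply: (@gder_le _ _ K2); first by rewrite !leq_max leqnn !orbT.
  rewrite -!(cat_cons y p).
  case/lastP: (y :: p) (isT : y :: p != [::]) => // q z _; rewrite -cats1 -!catA.
  apply: (gder_ctx q s (K2P (z, r) _)); apply/allpairsP.
  by exists (z, r); rewrite mem_enum.
Qed.

Lemma has_diagram_ar : all (fun r : word A => 1 < size r) (relators P) ->
  exists K, forall n w, ar n w [::] -> has_diagram P w (K * n.+1).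
Proof.
move=> P1; have [K1 K1P] := has_diagram_gder P1; have [K2 K2P] := gder_astep.
have arP n y u v : ar n u v -> gder P (n * K2) (y :: u) (y :: v).
  elim=> [k w|k w w' w'' st _ IH]; first exact: GDer0.
  by rewrite mulSn; exact: gder_trans (K2P _ _ _ st) IH.
exists ((K1 + 1) * (K2 + 2)).+1 => n [|y w] wn.
  by apply: has_diagram_le (has_diagram_nil P); rewrite muln_gt0.
(* With y y^-1 inserted behind the first letter, a second copy of the whole word follows a nonempty
   prefix; it is derived to nothing there, and y y^-1 is deleted last. *)
have d1 : gder P K2 (y :: w) [:: y, linv y, y & w].
  by apply: K2P; right; have := AFree [::] (linv y) w; rewrite linvK.
have d2 := arP _ y _ _ (ar_ctx [:: linv y] [::] wn).
have d3 : gder P 1 [:: y; linv y] [::] by apply: gder1; exact: (@GDel _ P [::] y [::]).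
rewrite /= cats0 in d2.
have := K1P _ _ _ _ (gder_trans d1 (gder_trans d2 d3)) (has_diagram_nil P).
by apply: has_diagram_le; nia.
Qed.

End Area.


(** * Insertions and the link of the presentation complex *)

Section Turns.
Variables (A : finType) (P : presentation A).

(** The third letter in the pattern is the nonempty rest required by [insertable_turn]; relators of
    length 2 give no turns. *)
Definition turns_of (r : word A) : seq ((A * bool) * (A * bool)) :=
  pmap (fun i => if rot i r is [:: x, l, _ & _] then Some (x, l) else None)
    (iota 0 (size r)).

Definition turns := undup (flatten [seq turns_of r ++ turns_of (winv r) | r <- relators P]).

Definition turn_targets (ts : seq ((A * bool) * (A * bool))) (s : seq (A * bool)) :=
  undup [seq e.2 | e <- ts & e.1 \in s].

Fixpoint turn_reachable ts n s :=
  if n is n'.+1 then turn_reachable ts n' (undup (s ++ turn_targets ts (map (@linv A) s)))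
  else s.

Lemma insertable_turns e : e \in turns -> insertable P e.1 e.2.
Proof.
have turn r : cyclic_relator P r -> e \in turns_of r -> insertable P e.1 e.2.
  rewrite mem_pmap => c /mapP[i _]; case rE: (rot i r) => [|x [|l [|y s]]] //= [->] /=.
  apply: (@insertable_turn _ _ _ _ (y :: s)) => //; rewrite -rE.
  by move: c; rewrite -{1}(cat_take_drop i r); exact: cyclic_relator_rot.
rewrite mem_undup => /flatten_mapP[r rP]; have c := cyclic_relator_id rP.
by rewrite mem_cat => /orP[]; apply: turn => //; exact: cyclic_relator_winv.
Qed.

(* The link of the vertex of the presentation complex has one vertex for each
   letter, and each turn (x, l) is an edge from linv x to l; insertions are
   available at every turn as soon as the link is connected. *)
Lemma insertable_reachable n x l :
  l \in turn_reachable turns n (turn_targets turns [:: x]) -> insertable P x l.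
Proof.
have tgt s e : e \in turn_targets turns s -> exists2 y, y \in s & insertable P y e.
  rewrite mem_undup => /mapP[y]; rewrite mem_filter => /andP[ys /insertable_turns yi ->].
  by exists y.1.
have : {in turn_targets turns [:: x], forall m, insertable P x m}.
  by move=> m /tgt[y]; rewrite inE => /eqP ->.
elim: n (turn_targets _ _) => [|n IHn] s sI /=; first exact: sI.
apply: IHn => m; rewrite mem_undup mem_cat => /orP[/sI //|/tgt[_ /mapP[k ks ->]]].
by apply: insertable_trans; exact: sI.
Qed.

End Turns.

Lemma insertable_Gamma_t x l : insertable Gamma_t x l.
Proof.
(* Four rounds of the search after the initial turns reach every letter from every letter. *)
apply: (@insertable_reachable _ _ 4).
pose ts := turns Gamma_t; pose letters : seq (abcdt * bool) :=
  [seq (y, b) | y <- [:: Some ga; Some gb; Some gc; Some gd; None], b <- [:: true; false]].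
have : all (fun x => all [in turn_reachable ts 4 (turn_targets ts [:: x])] letters) letters.
  by vm_compute.
have mem (y : abcdt * bool) : y \in letters.
  by move: y => [[[]|] []].
by move=> /allP/(_ _ (mem x))/allP/(_ _ (mem l)).
Qed.

Lemma has_diagram_Gamma_t : exists K, forall n w,
  ar Gamma_t n w [::] -> has_diagram Gamma_t w (K * n.+1).
Proof. by apply: has_diagram_ar; [exact: insertable_Gamma_t|vm_compute]. Qed.

(** * The Grigorchuk group *)


Definition posw (w : seq abcd) : word abcdt := [seq gen (Some g : abcdt) | g <- w].

Definition sigma1 (g : abcd) : seq abcd :=
  match g with ga => [:: ga; gc; ga] | gb => [:: gd] | gc => [:: gb] | gd => [:: gc] end.

Definition sigmaw (w : seq abcd) : seq abcd := flatten (map sigma1 w).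

Lemma sigmaw_cat u v : sigmaw (u ++ v) = sigmaw u ++ sigmaw v.
Proof. by rewrite /sigmaw map_cat flatten_cat. Qed.

Lemma iter_sigmaw_cat n u v :
  iter n sigmaw (u ++ v) = iter n sigmaw u ++ iter n sigmaw v.
Proof. by elim: n => //= n ->; rewrite sigmaw_cat. Qed.

(* Wreath recursion of the Grigorchuk group: b = (a, c), c = (a, d), d = (1, b). *)
Definition section1 (e : bool) (g : abcd) : option abcd :=
  match g, e with
  | gb, false | gc, false => Some ga
  | gb, true => Some gc
  | gc, true => Some gd
  | gd, true => Some gb
  | _, _ => None
  end.

Fixpoint act1 (g : abcd) (v : seq bool) : seq bool :=
  match v with
  | [::] => [::]
  | e :: v' =>
    match g with
    | ga => ~~ e :: v'
    | _ => e :: (if section1 e g is Some h then act1 h v' else v')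
    end
  end.

Definition act (w : seq abcd) (v : seq bool) : seq bool :=
  foldl (fun v g => act1 g v) v w.

Definition trivial_act (w : seq abcd) : Prop := forall v, act w v = v.

Fixpoint sect (e : bool) (w : seq abcd) : seq abcd :=
  match w with
  | [::] => [::]
  | ga :: w' => sect (~~ e) w'
  | g :: w' => (if section1 e g is Some h then [:: h] else [::]) ++ sect e w'
  end.

Lemma act_cat u v x : act (u ++ v) x = act v (act u x).
Proof. exact: foldl_cat. Qed.

Lemma act_sect w e v :
  act w (e :: v) = (e (+) odd (count_mem ga w)) :: act (sect e w) v.
Proof.
elim: w e v => [|g w IHw] e v /=; first by rewrite addbF.
by case: g => /=; case: e => /=; rewrite IHw //=; case: (odd _).
Qed.

Lemma act_nil w : act w [::] = [::].
Proof. by elim: w => //= -[] w IHw. Qed.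

Lemma trivial_actP w : trivial_act w <->
  ~~ odd (count_mem ga w) /\ forall e, trivial_act (sect e w).
Proof.
split=> [wT|[wE wT] [|e v]]; last 2 first.
- exact: act_nil.
- by rewrite act_sect (negPf wE) addbF wT.
split=> [|e v]; last by have := wT (e :: v); rewrite act_sect => -[].
by have := wT [:: false]; rewrite act_sect => -[] /= ->.
Qed.

Lemma act1K g v : act1 g (act1 g v) = v.
Proof.
elim: v g => // e v IHv [] /=; first by rewrite negbK.
all: by case: e => /=; rewrite ?IHv.
Qed.

Lemma act1_bcd v : act1 gd (act1 gc (act1 gb v)) = v.
Proof.
suff: (act1 gd (act1 gc (act1 gb v)) = v) /\ (act1 gb (act1 gd (act1 gc v)) = v) /\
  (act1 gc (act1 gb (act1 gd v)) = v) by case.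
elim: v => // e v [h1 [h2 h3]]; case: e => /=; first by rewrite h1 h2 h3.
by rewrite !act1K.
Qed.

Lemma trivial_act_sq g : trivial_act [:: g; g].
Proof. by move=> v; rewrite /act /= act1K. Qed.

Lemma trivial_act_bcd : trivial_act [:: gb; gc; gd].
Proof. by move=> v; rewrite /act /= act1_bcd. Qed.

Definition adw := [:: ga; gd].
Definition adacacw := [:: ga; gd; ga; gc; ga; gc].

Lemma trivial_act_ad4 : trivial_act (flatten (nseq 4 adw)).
Proof.
apply/trivial_actP; split=> // -[] v; by rewrite /act /= !act1K.
Qed.

Lemma trivial_act_adacac4 : trivial_act (flatten (nseq 4 adacacw)).
Proof.
apply/trivial_actP; split=> // -[] v; by rewrite /act /= !act1K.
Qed.

(* The dihedral group of order 8; Dadad is its central element, also equal to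
   dada. *)
Inductive d8 := D1 | Da | Dd | Dad | Dda | Dada | Ddad | Dadad.

Definition d8_code (q : d8) : bool * bool * bool :=
  match q with
  | D1 => (false, false, false) | Da => (false, false, true)
  | Dd => (false, true, false) | Dad => (false, true, true)
  | Dda => (true, false, false) | Dada => (true, false, true)
  | Ddad => (true, true, false) | Dadad => (true, true, true)
  end.
Definition d8_decode (x : bool * bool * bool) : d8 :=
  match x with
  | (false, false, false) => D1 | (false, false, true) => Da
  | (false, true, false) => Dd | (false, true, true) => Dad
  | (true, false, false) => Dda | (true, false, true) => Dada
  | (true, true, false) => Ddad | (true, true, true) => Dadad
  end.
Lemma d8_codeK : cancel d8_code d8_decode.
Proof. by case. Qed.
HB.instance Definition _ := Finite.copy d8 (can_type d8_codeK).

Definition d8a (q : d8) : d8 :=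
  match q with
  | D1 => Da | Da => D1 | Dd => Dda | Dad => Dada
  | Dda => Dd | Dada => Dad | Ddad => Dadad | Dadad => Ddad
  end.
Definition d8d (q : d8) : d8 :=
  match q with
  | D1 => Dd | Da => Dad | Dd => D1 | Dad => Da
  | Dda => Ddad | Dada => Dadad | Ddad => Dda | Dadad => Dada
  end.
Definition d8_word (q : d8) : seq abcd :=
  match q with
  | D1 => [::] | Da => [:: ga] | Dd => [:: gd] | Dad => [:: ga; gd]
  | Dda => [:: gd; ga] | Dada => [:: ga; gd; ga] | Ddad => [:: gd; ga; gd]
  | Dadad => [:: ga; gd; ga; gd]
  end.
(** The automorphism exchanging the generators a and d; after the quotient map of [d8_step] it
    becomes [phiw], the first coordinate of [sigmaw]. *)
Definition d8_swap (q : d8) : d8 :=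
  match q with
  | Da => Dd | Dd => Da | Dad => Dda | Dda => Dad | Dada => Ddad | Ddad => Dada
  | q => q
  end.

(* Right multiplication by the image of g in Grig / <<b>>, which is dihedral of
   order 8. *)
Definition d8_step (q : d8) (g : abcd) : d8 :=
  match g with ga => d8a q | gb => q | gc => d8d q | gd => d8d q end.

Definition d8_run (q : d8) (w : seq abcd) : d8 := foldl d8_step q w.

Definition level3_state := (seq (seq bool) * d8)%type.

Definition level3 : seq (seq bool) :=
  [seq [:: x; y.1; y.2] | x <- [:: false; true],
     y <- [:: (false, false); (false, true); (true, false); (true, true)]].

Definition level3_step (s : level3_state) (g : abcd) : level3_state :=
  (map (act1 g) s.1, d8_step s.2 g).

Fixpoint level3_search n (found front : seq level3_state) : seq level3_state :=
  if n is n'.+1 then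
    let new := undup [seq s <- [seq level3_step s g | s <- front, g <- [:: ga; gb; gc; gd]]
                     | s \notin found] in
    level3_search n' (found ++ new) new
  else found.

Definition level3_closed (R : seq level3_state) : bool :=
  [&& (level3, D1) \in R,
      all (fun s => all (fun g => level3_step s g \in R) [:: ga; gb; gc; gd]) R &
      all (fun s => (s.1 == level3) ==> (s.2 == D1)) R].

Lemma level3_statesP : exists R, level3_closed R.
Proof.
(* The number 20 is only the depth of the search; [level3_closed] certifies that no state is
   missing. *)
exists (level3_search 20 [:: (level3, D1)] [:: (level3, D1)]).
by vm_compute.
Qed.

(* <<b>> contains the stabilizer of the third level of the tree, so the image
   in the dihedral quotient can be read off the action on that level. *)
Lemma d8_run_trivial w : trivial_act w -> d8_run D1 w = D1.
Proof.
move=> wT; have [R /and3P[R0 /allP Rs /allP Re]] := level3_statesP.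
have mem g : g \in [:: ga; gb; gc; gd] by case: g.
have runR s u : s \in R -> foldl level3_step s u \in R.
  elim: u s => //= g u IHu s /Rs/allP/(_ g (mem g)); exact: IHu.
have runE s u : foldl level3_step s u = (map (act u) s.1, d8_run s.2 u).
  elim: u s => [|g u IHu] [s q] /=; first by rewrite map_id.
  by rewrite IHu /= -map_comp.
have wl : map (act w) level3 = level3 by rewrite (eq_map wT) map_id.
by move: (Re _ (runR _ w R0)); rewrite runE /fst /snd wl eqxx => /eqP.
Qed.

Lemma act_adad v : act [:: ga; gd; ga; gd] v = act [:: gd; ga; gd; ga] v.
Proof. by case: v => [|[] v]. Qed.

Definition phi1 (g : abcd) : seq abcd :=
  match g with ga => [:: gd] | gb => [::] | gc => [:: ga] | gd => [:: ga] end.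

Definition phiw (w : seq abcd) : seq abcd := flatten (map phi1 w).

(** phi kills b and identifies c with d, so it factors through the dihedral quotient, up to the swap
    of generators. Besides squares, the one relation needed on the tree is [act_adad]. *)
Lemma act_phiw q w v :
  act (d8_word (d8_swap q) ++ phiw w) v = act (d8_word (d8_swap (d8_run q w))) v.
Proof.
elim: w q v => [|g w IHw] q v; first by rewrite cats0.
rewrite /= -IHw /phiw /= catA act_cat [RHS]act_cat; congr act; rewrite act_cat.
have adad x : act1 gd (act1 ga (act1 gd (act1 ga x))) = act1 ga (act1 gd (act1 ga (act1 gd x))).
  exact: act_adad.
by case: q; case: g => //=; rewrite /act /= ?act1K // adad ?act1K.
Qed.

Lemma sect_sigmaw w : (sect true (sigmaw w) = w) * (sect false (sigmaw w) = phiw w).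
Proof.
by elim: w => //= -[] w [IH1 IH2]; split; rewrite /= ?IH1 ?IH2.
Qed.

Lemma count_sigmaw w : odd (count_mem ga (sigmaw w)) = false.
Proof. by elim: w => //= g w; rewrite count_cat oddD => ->; case: g. Qed.

(** As sigma(w) = (phi(w), w), the second coordinate shows that triviality is reflected. Conversely
    phi(w) is trivial because a trivial word has trivial image in the dihedral quotient. *)
Lemma trivial_act_sigmaw w : trivial_act w <-> trivial_act (sigmaw w).
Proof.
split=> [wT|/trivial_actP[_ /(_ true)]]; last by rewrite sect_sigmaw.
apply/trivial_actP; split=> [|[] v]; rewrite ?count_sigmaw ?sect_sigmaw //.
by have := act_phiw D1 w v; rewrite d8_run_trivial.
Qed.

Lemma trivial_act_iter n w : trivial_act w <-> trivial_act (iter n sigmaw w).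
Proof. by elim: n => //= n ->; exact: trivial_act_sigmaw. Qed.

(* Reading a word over {a,b,c,d,t} at height h: t raises the height and a
   letter g acts on the tree as sigma^h(g). *)
Definition run1 (s : nat * seq bool) (l : abcdt * bool) : nat * seq bool :=
  match l.1 with
  | Some g => (s.1, act (iter s.1 sigmaw [:: g]) s.2)
  | None => (if l.2 then s.1.-1 else s.1.+1, s.2)
  end.

Definition run s (w : word abcdt) := foldl run1 s w.

(** Heights are natural numbers and [run1] truncates at 0, so equality is required only from large
    heights, where no truncation occurs. *)
Definition run_eq u v := exists N, forall h x, N <= h -> run (h, x) u = run (h, x) v.

Lemma run_cat s u v : run s (u ++ v) = run (run s u) v.
Proof. exact: foldl_cat. Qed.

Lemma run_height s w : s.1 <= (run s w).1 + size w.
Proof.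
elim: w s => [|l w IHw] s; first by rewrite addn0.
have := IHw (run1 s l); rewrite /= addnS -addSn => /leq_trans h.
have : s.1 <= (run1 s l).1.+1 by case: l {h} => [[g|] []] /=; lia.
by move=> h'; apply: leq_trans h' _; rewrite addSn ltnS; exact: h.
Qed.

Lemma run_posw h x w : run (h, x) (posw w) = (h, act (iter h sigmaw w) x).
Proof.
elim: w x => [|g w IHw] x.
  by have -> : iter h sigmaw [::] = [::] by elim: h => //= h ->.
by rewrite /= IHw -[g :: w]cat1s iter_sigmaw_cat act_cat.
Qed.

Lemma run_eq_cancel l : run_eq [:: l; linv l] [::].
Proof.
exists 1 => h x; case: l => [[g|] []]; try by case: h.
all: move=> _; rewrite /run /= /run1 /=; congr pair; rewrite -act_cat -iter_sigmaw_cat.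
all: exact: (proj1 (trivial_act_iter h _) (trivial_act_sq g)).
Qed.

Lemma run_eq_relator r : r \in relators Gamma_t -> run_eq r [::].
Proof.
have pos w : trivial_act w -> run_eq (posw w) [::].
  by move=> wT; exists 0 => h x _; rewrite run_posw (proj1 (trivial_act_iter h w) wT).
rewrite mem_cat => /orP[|/mapP[g _ ->]].
  have [[[a2 b2] c2] d2] :=
    (trivial_act_sq ga, trivial_act_sq gb, trivial_act_sq gc, trivial_act_sq gd).
  rewrite !inE => /or4P[/eqP->|/eqP->|/eqP->|];
    [exact: (pos _ a2)|exact: (pos _ b2)|exact: (pos _ c2)|].
  case/or4P=> /eqP->;
    [exact: (pos _ d2)|exact: (pos _ trivial_act_bcd)|exact: (pos _ trivial_act_ad4)|].
  exact: (pos _ trivial_act_adacac4).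
exists 0 => h x _.
have -> : t_relator g = [:: t_letter] ++ posw [:: g] ++ [:: linv t_letter] ++
    winv (lift_word (sigma g)) by [].
have up : run (h, x) [:: t_letter] = (h.+1, x) by [].
have down y : run (h.+1, y) [:: linv t_letter] = (h, y) by [].
rewrite !run_cat up run_posw down iterSr.
(* Each [sigma g] is a palindrome, and [run1] ignores the signs of letters other than t. *)
have -> y : run (h, y) (winv (lift_word (sigma g))) = run (h, y) (posw (sigma1 g)).
  by case: g.
have -> : sigmaw [:: g] = sigma1 g by case: g.
rewrite run_posw -act_cat -iter_sigmaw_cat; congr pair; apply: (proj1 (trivial_act_iter h _)) => y.
by case: g; rewrite /act /= ?act1K.
Qed.

Lemma eqv_run_eq u v : eqv Gamma_t u v -> run_eq u v.
Proof.
have ctx p r s : run_eq r [::] -> run_eq (p ++ r ++ s) (p ++ s).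
  case=> N rN; exists (N + size p) => h x hN; rewrite !run_cat.
  have := run_height (h, x) p; case: (run (h, x) p) => h' x' /= hh.
  by rewrite rN // -(leq_add2r (size p)); exact: leq_trans hN hh.
have ast p q : astep Gamma_t p q -> run_eq p q.
  by case=> [? ? ?|? ? ? /run_eq_relator]; apply: ctx => //; exact: run_eq_cancel.
case=> n; elim=> [m w|m w w' w'' st _ [N IH]]; first by exists 0.
have [M wM] : run_eq w w'.
  by case: st => /ast // [M wM]; exists M => h x hM; rewrite wM.
by exists (maxn M N) => h x; rewrite geq_max => /andP[/wM -> /IH ->].
Qed.

(** * Commutation relations *)


Notation tp := t_letter.
Notation tm := (linv t_letter).

Definition arp n (u v : seq abcd) := ar Gamma_t n (posw u) (posw v).
Definition peqv (u v : seq abcd) := eqv Gamma_t (posw u) (posw v).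

Lemma posw_cat u v : posw (u ++ v) = posw u ++ posw v.
Proof. exact: map_cat. Qed.

Lemma peqv_refl u : peqv u u. Proof. exact: eqv_refl. Qed.
Lemma peqv_sym u v : peqv u v -> peqv v u. Proof. exact: eqv_sym. Qed.
Lemma peqv_trans v u w : peqv u v -> peqv v w -> peqv u w. Proof. exact: eqv_trans. Qed.

Lemma peqv_ctx p s u v : peqv u v -> peqv (p ++ u ++ s) (p ++ v ++ s).
Proof. by rewrite /peqv !posw_cat; exact: eqv_ctx. Qed.

Lemma arp_ctx p s n u v : arp n u v -> arp n (p ++ u ++ s) (p ++ v ++ s).
Proof. by rewrite /arp !posw_cat; exact: ar_ctx. Qed.

Lemma arp_trans m n u v w : arp m u v -> arp n v w -> arp (m + n) u w.
Proof. exact: ar_trans. Qed.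

Lemma peqv_relator w : lift_word [seq gen g | g <- w] \in relators Gamma_t -> peqv w [::].
Proof.
move=> rP; exists 1; have := ar_relator [::] [::] rP.
by rewrite cats0 /= /lift_word -map_comp.
Qed.

Lemma peqv_sq g : peqv [:: g; g] [::].
Proof. by case: g; apply: peqv_relator. Qed.

Lemma peqv_catV u : peqv (u ++ rev u) [::].
Proof.
elim: u => [|g u IHu]; first exact: peqv_refl.
apply: peqv_trans (peqv_sq g); rewrite rev_cons -cats1.
rewrite -[(g :: u) ++ _]/([:: g] ++ u ++ rev u ++ [:: g]) (catA u).
exact: (peqv_ctx [:: g] [:: g] IHu).
Qed.

Lemma peqv_Vcat u : peqv (rev u ++ u) [::].
Proof. by rewrite -{2}[u]revK; exact: peqv_catV. Qed.

Lemma peqv_rev u v : peqv u v -> peqv (rev u) (rev v).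
Proof.
move=> uv; apply: (@peqv_trans (rev u ++ v ++ rev v)).
  by apply: peqv_sym; have := peqv_ctx (rev u) [::] (peqv_catV v); rewrite !cats0.
apply: (@peqv_trans (rev u ++ u ++ rev v)); first exact: peqv_ctx (peqv_sym uv).
by rewrite catA; exact: (peqv_ctx [::] (rev v) (peqv_Vcat u)).
Qed.

Lemma peqv_split u v : peqv (u ++ v) [::] -> peqv u (rev v).
Proof.
move=> uv; apply: (@peqv_trans (u ++ v ++ rev v)).
  by apply: peqv_sym; have := peqv_ctx u [::] (peqv_catV v); rewrite !cats0.
by rewrite catA; exact: (peqv_ctx [::] (rev v) uv).
Qed.

Lemma eqv_split u v : eqv Gamma_t (u ++ winv v) [::] -> eqv Gamma_t u v.
Proof.
move=> uv; apply: (@eqv_trans _ _ (u ++ winv v ++ v)).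
  by apply: eqv_sym; have := eqv_ctx u [::] (eqv_Vcat Gamma_t v); rewrite !cats0.
by rewrite catA; exact: (eqv_ctx [::] v uv).
Qed.

Lemma eqv_t_letter g : eqv Gamma_t (tp :: posw [:: g]) (posw (sigma1 g) ++ [:: tp]).
Proof.
apply: eqv_split; exists 1.
have rP : t_relator g \in relators Gamma_t.
  by rewrite mem_cat; apply/orP; right; apply: map_f; case: g.
have := ar_relator [::] [::] rP; rewrite cats0 /=; by case: g {rP}.
Qed.

Lemma ar_t_word : exists c, forall w,
  ar Gamma_t (c * size w) (tp :: posw w) (posw (sigmaw w) ++ [:: tp]).
Proof.
have [c cP] : exists c, forall g, g \in enum {: abcd} ->
    ar Gamma_t c (tp :: posw [:: g]) (posw (sigma1 g) ++ [:: tp]).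
  apply: bounded_choice => [m n g mn|g _]; first exact: ar_le.
  exact: eqv_t_letter.
exists c; elim=> [|g w IHw]; first exact: Ar0.
rewrite mulnS; apply: (@ar_trans _ _ _ _ _ (posw (sigma1 g) ++ [:: tp] ++ posw w)).
  have gE : g \in enum {: abcd} by rewrite mem_enum.
  by have := ar_ctx [::] (posw w) (cP g gE); rewrite /= -!catA.
rewrite [sigmaw (g :: w)]/(sigma1 g ++ sigmaw w) posw_cat.
by have := ar_ctx (posw (sigma1 g)) [::] IHw; rewrite !cats0 /= -!catA.
Qed.

Lemma ar_t_conj : exists c, forall w,
  ar Gamma_t (c * (size w).+1) (posw (sigmaw w)) (tp :: posw w ++ [:: tm]).
Proof.
have [c cP] := ar_t_word; exists c.+1 => w.
apply: (@ar_le _ _ (1 + c * size w)); first by nia.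
apply: (@ar_trans _ _ _ _ _ (posw (sigmaw w) ++ [:: tp; tm])).
  by have := ar_sym (ar_cancel Gamma_t (posw (sigmaw w)) tp [::]); rewrite !cats0.
have := ar_ctx [::] [:: tm] (ar_sym (cP w)).
by rewrite /= -!catA.
Qed.

Lemma peqv_sigma u v : peqv u v -> peqv (sigmaw u) (sigmaw v).
Proof.
have [c cP] := ar_t_conj.
have cj w : eqv Gamma_t (posw (sigmaw w)) (tp :: posw w ++ [:: tm]) by exists (c * (size w).+1).
move=> uv; apply: eqv_trans (cj u) _; apply: eqv_trans (eqv_sym (cj v)).
exact: (eqv_ctx [:: tp] [:: tm] uv).
Qed.

(** * Proving relations by computation *)

Section Rewriting.
Variable rules : seq (seq abcd * seq abcd).

Fixpoint rw_head (rs : seq (seq abcd * seq abcd)) (w : seq abcd) :=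
  if rs is r :: rs' then
    if take (size r.1) w == r.1 then Some (r.2 ++ drop (size r.1) w) else rw_head rs' w
  else None.

Fixpoint rw1 (w : seq abcd) : option (seq abcd) :=
  if rw_head rules w is Some w' then Some w' else
  if w is x :: w' then omap (cons x) (rw1 w') else None.

Fixpoint rw_norm n (w : seq abcd) : seq abcd :=
  if n is n'.+1 then if rw1 w is Some w' then rw_norm n' w' else w else w.

Hypothesis rulesP : forall r, r \in rules -> peqv r.1 r.2.

Lemma peqv_rw_norm n u : peqv u (rw_norm n u).
Proof.
have head rs w w' : {subset rs <= rules} -> rw_head rs w = Some w' -> peqv w w'.
  elim: rs => //= r rs IHrs rsP; case: eqP => [rE [<-]|_ /IHrs]; last first.
    by apply=> x xr; apply: rsP; rewrite inE xr orbT.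
  rewrite -{1}(cat_take_drop (size r.1) w) rE.
  exact: (peqv_ctx [::] _ (rulesP (rsP _ (mem_head _ _)))).
have one w w' : rw1 w = Some w' -> peqv w w'.
  elim: w w' => [|x w IHw] w' /=; case hE: (rw_head rules _) => [z|] //=.
  - by case=> <-; exact: head hE.
  - by case=> <-; exact: head hE.
  - case: (rw1 w) IHw => //= z /(_ _ erefl) wz [<-].
    by have := peqv_ctx [:: x] [::] wz; rewrite !cats0.
elim: n u => [|n IHn] u /=; first exact: peqv_refl.
case E: (rw1 u) => [w|]; last exact: peqv_refl.
exact: peqv_trans (one _ _ E) (IHn w).
Qed.

(** Equal results after [n] rewriting steps suffice; neither termination nor confluence enters. *)
Lemma peqv_rw n u v : rw_norm n u == rw_norm n v -> peqv u v.
Proof.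
by move=> /eqP E; apply: peqv_trans (peqv_rw_norm n u) _; rewrite E; exact/peqv_sym/peqv_rw_norm.
Qed.

End Rewriting.

(** The last two rules express (ad)^4 and its image (ac)^8 under sigma. The relator (adacac)^4 is
    kept apart and applied by hand. *)
Definition grig_rules : seq (seq abcd * seq abcd) :=
  [seq ([:: g; g], [::]) | g <- [:: ga; gb; gc; gd]] ++
  [:: ([:: gb; gc], [:: gd]); ([:: gc; gb], [:: gd]); ([:: gb; gd], [:: gc]);
      ([:: gd; gb], [:: gc]); ([:: gc; gd], [:: gb]); ([:: gd; gc], [:: gb]);
      ([:: ga; gd; ga; gd], [:: gd; ga; gd; ga]);
      ([:: ga; gc; ga; gc; ga; gc; ga; gc], [:: gc; ga; gc; ga; gc; ga; gc; ga])].

Lemma grig_rulesP r : r \in grig_rules -> peqv r.1 r.2.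
Proof.
have bcd : peqv ([:: gb; gc] ++ [:: gd]) [::] by exact: peqv_relator.
have bc : peqv [:: gb; gc] [:: gd] := peqv_split bcd.
have dc : peqv [:: gd; gc] [:: gb].
  by apply: peqv_sym; exact: (@peqv_split [:: gb] [:: gc; gd]).
have bd : peqv [:: gb; gd] [:: gc].
  apply: (@peqv_trans ([:: gb; gb] ++ [:: gc])); last exact: (peqv_ctx [::] [:: gc] (peqv_sq gb)).
  by apply: peqv_sym; exact: (peqv_ctx [:: gb] [::] bc).
have ad : peqv [:: ga; gd; ga; gd] [:: gd; ga; gd; ga].
  by apply: (@peqv_split [:: ga; gd; ga; gd] [:: ga; gd; ga; gd]); exact: peqv_relator.
rewrite mem_cat => /orP[/mapP[g _ ->]|]; first exact: peqv_sq.
rewrite !inE => /or4P[||/eqP->|/or4P[/eqP->|/eqP->|/eqP->|/orP[]]] =>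
  [/eqP->|/eqP->|||||/eqP->|/eqP->].
- exact: bc.
- exact: (peqv_rev bc).
- exact: bd.
- exact: (peqv_rev bd).
- exact: (peqv_rev dc).
- exact: dc.
- exact: ad.
- exact: (peqv_sigma ad).
Qed.

Lemma peqv_grig u v : rw_norm grig_rules 200 u == rw_norm grig_rules 200 v -> peqv u v.
Proof. by apply: peqv_rw; exact: grig_rulesP. Qed.

(** Left multiplication by d, whereas [d8_step] multiplies on the right. *)
Definition d8_ld (q : d8) := d8_run Dd (d8_word q).

Definition beta (q : d8) := d8_word q ++ [:: gb] ++ rev (d8_word q).

(* The element (1, b^q^-1) for (true, q), and (b^q'^-1, 1), where q' is the swap
   of q, for (false, q). *)
Definition emission (iq : bool * d8) : seq abcd :=
  if iq.1 then sigmaw (beta iq.2) else [:: ga] ++ sigmaw (beta (d8_swap iq.2)) ++ [:: ga].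

(** Conjugation by c, which commutes with d, turns the index d q into q, so one index of each such
    pair suffices. For [D1] and [Da] rewriting is enough; [Dad] and [Dada] need (adacac)^4. *)
Lemma emission_d_comm q : peqv (emission (false, q) ++ [:: gd]) ([:: gd] ++ emission (false, q)).
Proof.
have conj p : peqv ([:: gc] ++ emission (false, d8_ld p) ++ [:: gc]) (emission (false, p)).
  by case: p; apply: peqv_grig; vm_compute.
have d_conj p :
    peqv (emission (false, d8_ld p) ++ [:: gd]) ([:: gd] ++ emission (false, d8_ld p)) ->
    peqv (emission (false, p) ++ [:: gd]) ([:: gd] ++ emission (false, p)).
  move=> h; set X := emission (false, d8_ld p) in h conj *.
  have dc : peqv [:: gc; gd] [:: gd; gc] by apply: peqv_grig; vm_compute.
  apply: (@peqv_trans ([:: gc] ++ X ++ [:: gc] ++ [:: gd])).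
    have := peqv_ctx [::] [:: gd] (peqv_sym (conj p)); by rewrite -!catA.
  apply: (@peqv_trans ([:: gc] ++ X ++ [:: gd] ++ [:: gc])).
    by have := peqv_ctx ([:: gc] ++ X) [::] dc; rewrite !cats0 -!catA.
  apply: (@peqv_trans ([:: gc] ++ [:: gd] ++ X ++ [:: gc])).
    have := peqv_ctx [:: gc] [:: gc] h; by rewrite -!catA.
  apply: (@peqv_trans ([:: gd] ++ [:: gc] ++ X ++ [:: gc])).
    exact: (peqv_ctx [::] (X ++ [:: gc]) dc).
  have := peqv_ctx [:: gd] [::] (conj p); by rewrite !cats0.
have adacac q' : q' \in [:: Dad; Dada] ->
    peqv (emission (false, q') ++ [:: gd]) ([:: gd] ++ emission (false, q')).
  move=> q'P; set X := emission (false, q').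
  have rX : rev (X ++ [:: gd]) = [:: gd] ++ X by move: q'P; rewrite /X !inE => /orP[] /eqP ->.
  (* Up to the rules, the square of X d is the conjugate of (adacac)^4 by da. As X is a palindrome,
     a trivial square means that X and d commute. *)
  rewrite -rX; apply: peqv_split.
  apply: (@peqv_trans ([:: gd; ga] ++ flatten (nseq 4 adacacw) ++ [:: ga; gd])).
    by move: q'P; rewrite /X !inE => /orP[] /eqP ->; apply: peqv_grig; vm_compute.
  have rel : peqv (flatten (nseq 4 adacacw)) [::] by exact: peqv_relator.
  apply: peqv_trans (peqv_ctx _ _ rel) _.
  by apply: peqv_grig; vm_compute.
have D1P : peqv (emission (false, D1) ++ [:: gd]) ([:: gd] ++ emission (false, D1)).
  by apply: peqv_grig; vm_compute.
have DaP : peqv (emission (false, Da) ++ [:: gd]) ([:: gd] ++ emission (false, Da)).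
  by apply: peqv_grig; vm_compute.
case: q; try exact: D1P; try exact: DaP; try exact: adacac.
- exact: (d_conj Dd D1P).
- exact: (d_conj Dda DaP).
- exact: (d_conj Ddad (adacac Dad isT)).
- exact: (d_conj Dadad (adacac Dada isT)).
Qed.

(** In sigma(x) = (phi(x), x) only the first coordinate matters here; through the swap, conjugation
    by phi(x) multiplies the index by x on the left. *)
Lemma emission_sigma_comm q x : x \in [:: ga; gd] ->
  peqv (emission (false, q) ++ sigmaw [:: x])
    (sigmaw [:: x] ++ emission (false, d8_run (d8_run D1 [:: x]) (d8_word q))).
Proof.
by rewrite !inE => /orP[] /eqP ->; case: q; apply: peqv_grig; vm_compute.
Qed.

Lemma emission_word_comm q w : all [in [:: ga; gd]] w -> exists q',
  peqv (emission (false, q) ++ sigmaw w) (sigmaw w ++ emission (false, q')).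
Proof.
elim: w q => [|x w IHw] q /=; first by exists q; rewrite cats0; exact: peqv_refl.
case/andP=> /(emission_sigma_comm q) xq; set q1 := d8_run _ _ in xq => /(IHw q1)[q' wq].
exists q'; have -> : sigmaw (x :: w) = sigmaw [:: x] ++ sigmaw w by rewrite -sigmaw_cat.
apply: (@peqv_trans (sigmaw [:: x] ++ emission (false, q1) ++ sigmaw w)).
  by have := peqv_ctx [::] (sigmaw w) xq; rewrite -!catA.
by have := peqv_ctx (sigmaw [:: x]) [::] wq; rewrite !cats0 -!catA.
Qed.

(* Conjugating by sigma (d8_word q') reduces to commutation with d = sigma b. *)
Lemma emission_comm q q' :
  peqv (emission (false, q) ++ emission (true, q')) (emission (true, q') ++ emission (false, q)).
Proof.
set s := sigmaw (d8_word q').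
have E1 : emission (true, q') = s ++ [:: gd] ++ rev s by rewrite /s; case: (q').
have [|p ps] := @emission_word_comm q (d8_word q'); first by case: (q').
rewrite -/s in ps.
have rE r : rev (emission (false, r)) = emission (false, r) by case: r.
have ps' : peqv (emission (false, p) ++ rev s) (rev s ++ emission (false, q)).
  by have := peqv_rev ps; rewrite (rev_cat _ s) (rev_cat s) !rE; exact: peqv_sym.
rewrite E1; apply: (@peqv_trans (s ++ emission (false, p) ++ [:: gd] ++ rev s)).
  by have := peqv_ctx [::] ([:: gd] ++ rev s) ps; rewrite -!catA.
apply: (@peqv_trans (s ++ [:: gd] ++ emission (false, p) ++ rev s)).
  by have := peqv_ctx s (rev s) (emission_d_comm p); rewrite -!catA.
by have := peqv_ctx (s ++ [:: gd]) [::] ps'; rewrite !cats0 -!catA.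
Qed.

(** * Quadratic filling of words over a, b, c, d *)


Lemma arp_uniform (T : finType) (f g : T -> seq abcd) :
  (forall x, peqv (f x) (g x)) -> exists c, forall x, arp c (f x) (g x).
Proof.
move=> fg; have [c cP] : exists c, forall x, x \in enum T -> arp c (f x) (g x).
  by apply: bounded_choice => [m n x mn|x _]; [exact: ar_le|exact: fg].
by exists c => x; apply: cP; rewrite mem_enum.
Qed.

Lemma arp_le m n u v : m <= n -> arp m u v -> arp n u v.
Proof. exact: ar_le. Qed.

Lemma arp_sym n u v : arp n u v -> arp n v u.
Proof. exact: ar_sym. Qed.

Section Dihedral.

(** Coset rewriting for the normal closure of b, with the words [d8_word q] as representatives:
    moving [q] past b leaves the conjugate [beta q], and so does moving it past c = bd. *)
Fixpoint b_conjugates (q : d8) (w : seq abcd) : seq d8 :=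
  match w with
  | [::] => [::]
  | g :: w' => (if g is gb then [:: q] else if g is gc then [:: q] else [::])
                 ++ b_conjugates (d8_step q g) w'
  end.

Lemma arp_b_conjugates : exists c, forall w q,
  arp (c * size w) (d8_word q ++ w)
    (flatten (map beta (b_conjugates q w)) ++ d8_word (d8_run q w)).
Proof.
pose em q g := flatten (map beta (b_conjugates q [:: g])).
have [c cP] : exists c, forall qg : d8 * abcd, arp c (d8_word qg.1 ++ [:: qg.2])
    (em qg.1 qg.2 ++ d8_word (d8_step qg.1 qg.2)).
  apply: arp_uniform => -[q g] /=.
  by case: q; case: g; apply: peqv_grig; vm_compute.
exists c; elim=> [|g w IHw] q /=; first by rewrite cats0; exact: Ar0.
rewrite mulnS; apply: (@arp_trans _ _ _ (em q g ++ d8_word (d8_step q g) ++ w)).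
  by have := arp_ctx [::] w (cP (q, g)); rewrite /= -!catA.
rewrite map_cat flatten_cat -catA.
have := arp_ctx (em q g) [::] (IHw (d8_step q g)); rewrite !cats0.
by rewrite /em /= !cats0.
Qed.

Lemma size_b_conjugates q w : size (b_conjugates q w) <= size w.
Proof.
elim: w q => //= g w IHw q; rewrite size_cat; have := IHw (d8_step q g).
by case: g => /=; lia.
Qed.

Lemma arp_trivial_b_conjugates : exists c, forall w, trivial_act w ->
  arp (c * size w) (flatten (map beta (b_conjugates D1 w))) w.
Proof.
have [c cP] := arp_b_conjugates; exists c => w wT.
by have := arp_sym (cP w D1); rewrite d8_run_trivial // cats0.
Qed.

End Dihedral.

(** Coset representatives modulo the product of two copies of the normal closure of b, one in each
    coordinate: sigma(q) has coordinates (swap of q, q). *)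
Definition state_word (q : d8) (e : bool) : seq abcd :=
  sigmaw (d8_word q) ++ (if e then [:: ga] else [::]).

Definition state_step (q : d8) (e : bool) (g : abcd) : d8 * bool :=
  match g with
  | ga => (q, ~~ e)
  | gb | gc => (if e then d8a q else d8d q, e)
  | gd => (q, e)
  end.

(** The letters b = (a, c) and d = (1, b) each contribute one conjugate of b in one coordinate,
    because c is bd; the letter c = (a, d) contributes none. The flag [e] records whether the
    coordinates are exchanged. *)
Fixpoint emissions (q : d8) (e : bool) (w : seq abcd) : seq (bool * d8) :=
  match w with
  | [::] => [::]
  | g :: w' => (if g is gb then [:: (~~ e, q)] else if g is gd then [:: (~~ e, q)] else [::])
                 ++ emissions (state_step q e g).1 (state_step q e g).2 w'
  end.

Fixpoint final_state (q : d8) (e : bool) (w : seq abcd) : d8 * bool :=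
  if w is g :: w' then final_state (state_step q e g).1 (state_step q e g).2 w' else (q, e).

Definition emission_word (s : seq (bool * d8)) := flatten (map emission s).

Lemma emission_word_cat s t : emission_word (s ++ t) = emission_word s ++ emission_word t.
Proof. by rewrite /emission_word map_cat flatten_cat. Qed.

Lemma arp_emissions : exists c, forall w q e,
  arp (c * size w) (state_word q e ++ w)
    (emission_word (emissions q e w) ++
     state_word (final_state q e w).1 (final_state q e w).2).
Proof.
pose em q e g := emission_word (emissions q e [:: g]).
pose next_word q e g := state_word (state_step q e g).1 (state_step q e g).2.
have [c cP] : exists c, forall s : d8 * bool * abcd,
    arp c (state_word s.1.1 s.1.2 ++ [:: s.2])
    (em s.1.1 s.1.2 s.2 ++ next_word s.1.1 s.1.2 s.2).
  apply: arp_uniform => -[[q e] g] /=.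
  by case: q; case: e; case: g; apply: peqv_grig; vm_compute.
exists c; elim=> [|g w IHw] q e; first by rewrite cats0; exact: Ar0.
rewrite [c * _]mulnS; apply: (@arp_trans _ _ _ (em q e g ++ next_word q e g ++ w)).
  by have := arp_ctx [::] w (cP (q, e, g)); rewrite -!catA.
have := arp_ctx (em q e g) [::] (IHw (state_step q e g).1 (state_step q e g).2).
rewrite !cats0 -!catA /= emission_word_cat -!catA.
by rewrite /em /= cats0.
Qed.

Lemma size_emissions q e w : size (emissions q e w) <= size w.
Proof.
elim: w q e => //= g w IHw q e; rewrite size_cat.
have := IHw (state_step q e g).1 (state_step q e g).2.
by case: g => /=; lia.
Qed.

(** The sorted product returns to the sections in this way: each coordinate emits just the
    conjugates of b that are read off the corresponding section. *)
Lemma emissions_true q e w :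
  [seq p.2 | p <- emissions q e w & p.1] = b_conjugates q (sect (~~ e) w).
Proof.
elim: w q e => //= g w IHw q e; rewrite filter_cat map_cat IHw.
by case: g; case: e.
Qed.

Lemma emissions_false q e w :
  [seq d8_swap p.2 | p <- emissions q e w & ~~ p.1] = b_conjugates (d8_swap q) (sect e w).
Proof.
elim: w q e => //= g w IHw q e; rewrite filter_cat map_cat IHw.
by case: g; case: e; case: q.
Qed.

Lemma final_stateE q e w : final_state q e w =
  (d8_run q (sect (~~ e) w), e (+) odd (count_mem ga w)).
Proof.
elim: w q e => [|g w IHw] q e; first by rewrite /= addbF.
rewrite /= IHw; by case: g; case: e => /=; case: (odd _).
Qed.

(** Each emission with flag [false] is moved past all later ones with flag [true], at a constant
    price per exchange. Everything else in the splitting has linear cost. *)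
Lemma arp_sort_emissions : exists c, forall s : seq (bool * d8),
  arp (c * (size s * size s)) (emission_word s)
    (emission_word (filter fst s) ++ emission_word [seq p <- s | ~~ p.1]).
Proof.
have [c cP] : exists c, forall qq : d8 * d8,
    arp c (emission (false, qq.1) ++ emission (true, qq.2))
          (emission (true, qq.2) ++ emission (false, qq.1)).
  by apply: arp_uniform => -[q q'] /=; exact: emission_comm.
have move_past q (t : seq (bool * d8)) : all fst t ->
    arp (c * size t) (emission (false, q) ++ emission_word t)
      (emission_word t ++ emission (false, q)).
  elim: t => [|[i p] t IHt] /=; first by rewrite cats0; move=> _; exact: Ar0.
  case/andP=> /= -> /IHt{}IHt; rewrite mulnS.
  rewrite /emission_word /= -/(emission_word t).
  apply: (@arp_trans _ _ _ (emission (true, p) ++ emission (false, q) ++ emission_word t)).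
    by have := arp_ctx [::] (emission_word t) (cP (q, p)); rewrite /= -!catA.
  by have := arp_ctx (emission (true, p)) [::] IHt; rewrite !cats0 -!catA.
exists c; elim=> [|[i q] s IHs]; first exact: Ar0.
have ih := arp_ctx (emission (i, q)) [::] IHs; rewrite !cats0 in ih.
have sE : size ((i, q) :: s) = (size s).+1 by [].
rewrite sE [emission_word ((i, q) :: s)]/(emission (i, q) ++ emission_word s).
apply: (@arp_le (c * (size s * size s) + c * size s)); first by nia.
case: i ih {sE} => ih.
  rewrite -[emission_word (filter _ ((true, q) :: s))]
    /(emission (true, q) ++ emission_word (filter fst s)) -catA.
  exact: arp_le (leq_addr _ _) ih.
apply: arp_trans ih _.
set u := [seq p <- s | p.1]; set v := [seq p <- s | ~~ p.1].
apply: (@arp_le (c * size u)).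
  by rewrite leq_mul2l /u size_filter count_size orbT.
rewrite -[emission_word [seq p <- (false, q) :: s | ~~ p.1]]
  /(emission (false, q) ++ emission_word v) [X in arp _ X _]catA [X in arp _ _ X]catA.
exact: (arp_ctx [::] (emission_word v) (move_past q u (filter_all _ _))).
Qed.

Lemma emission_word_true s : all fst s ->
  emission_word s = sigmaw (flatten (map beta (map snd s))).
Proof.
elim: s => // -[i q] s IHs /= /andP[/= -> /IHs sE].
by rewrite sigmaw_cat -sE.
Qed.

Lemma arp_emission_word_false : exists c, forall s : seq (bool * d8), all (fun p => ~~ p.1) s ->
  arp (c * (size s).+1) (emission_word s)
    ([:: ga] ++ sigmaw (flatten (map beta (map (fun p => d8_swap p.2) s))) ++ [:: ga]).
Proof.
have [c aa] := peqv_sq ga; exists c; elim=> [_|[i q] s IHs] /=.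
  by rewrite muln1; exact: arp_sym.
case/andP=> /negPf /= -> /IHs{}IHs; rewrite mulnS addnC.
set w := flatten _ in IHs *; rewrite sigmaw_cat.
have := arp_ctx (emission (false, q)) [::] IHs; rewrite !cats0 => /arp_trans; apply.
have := arp_ctx ([:: ga] ++ sigmaw (beta (d8_swap q))) (sigmaw w ++ [:: ga]) aa.
by rewrite /emission /= -!catA.
Qed.

(** The longest [beta q] has two words of length 4 around b. *)
Lemma size_flatten_beta s : size (flatten (map beta s)) <= 9 * size s.
Proof.
elim: s => //= q s IHs; rewrite size_cat mulnS leq_add //; by case: q.
Qed.

Lemma size_sect e w : size (sect e w) <= size w.
Proof.
elim: w e => //= g w IHw e.
by case: g => /=; try (by apply: leqW); case: e => /=; rewrite ?ltnS ?IHw //; apply: leqW.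
Qed.

(* If w = (w0, w1) is trivial then w = sigma(w1) . a sigma(w0) a, since sigma(g)
   is (phi(g), g) and phi kills w0 and w1. *)
Lemma ar_split_sections : exists c, forall w, trivial_act w ->
  ar Gamma_t (c * (size w * size w + 1)) (posw w)
    (tp :: posw (sect true w) ++ [:: tm] ++
     posw [:: ga] ++ tp :: posw (sect false w) ++ [:: tm] ++ posw [:: ga]).
Proof.
have [c1 c1P] := arp_emissions; have [c2 c2P] := arp_sort_emissions.
have [c3 c3P] := arp_emission_word_false; have [c4 c4P] := ar_t_conj.
have [c5 c5P] := arp_trivial_b_conjugates.
exists (c1 + c2 + c3 * 2 + c4 * 20 + c5 * 2) => w wT.
have [wE wS] := proj1 (trivial_actP w) wT.
set s := emissions D1 false w; set n := size w.
have sn : size s <= n by exact: size_emissions.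
have s1 : arp (c1 * n) w (emission_word s).
  have := c1P w D1 false.
  by rewrite final_stateE /= (negPf wE) d8_run_trivial ?cats0 //; exact: wS.
have s2 := c2P s.
set t1 := filter fst s in s2; set t0 := [seq p <- s | ~~ p.1] in s2.
have t1E : emission_word t1 = sigmaw (flatten (map beta (b_conjugates D1 (sect true w)))).
  by rewrite emission_word_true ?filter_all // emissions_true.
have s3 := c3P t0 (filter_all _ _).
rewrite /t0 emissions_false -/t0 in s3.
have half e : ar Gamma_t (c4 * (9 * n).+1 + c5 * n)
    (posw (sigmaw (flatten (map beta (b_conjugates D1 (sect e w))))))
    (tp :: posw (sect e w) ++ [:: tm]).
  have sz := size_sect e w.
  apply: ar_trans (ar_le _ (c4P _)) _.
    rewrite leq_mul2l ltnS (leq_trans (size_flatten_beta _)) ?orbT // leq_mul2l.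
    by rewrite (leq_trans (size_b_conjugates _ _)).
  have := ar_ctx [:: tp] [:: tm] (c5P _ (wS e)); apply: ar_le.
  by rewrite leq_mul2l sz orbT.
apply: (@ar_le _ _ (c1 * n + (c2 * (size s * size s) +
  (c3 * (size t0).+1 + 2 * (c4 * (9 * n).+1 + c5 * n))))).
  have t0n : size t0 <= n by rewrite (leq_trans _ sn) // size_filter count_size.
  have ss : size s * size s <= n * n by exact: leq_mul.
  move: ss t0n; move: (size s * size s) (size t0) => x y; clear.
  by move=> hx hy; have : n <= n * n by [case: (n) => // m; nia]; nia.
apply: ar_trans s1 _; apply: ar_trans s2 _.
rewrite posw_cat t1E.
have := ar_ctx (posw (sigmaw (flatten (map beta (b_conjugates D1 (sect true w)))))) [::] s3.
rewrite !cats0 => /ar_trans; apply; rewrite !posw_cat mul2n -addnn.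
have h1 := half true; have h0 := ar_ctx (posw [:: ga]) (posw [:: ga]) (half false).
by have := ar_cat h1 h0; rewrite /= -!catA.
Qed.

Definition alternating (x y : abcd) : bool := (x == ga) != (y == ga).

Lemma size_sect_count e w : size (sect e w) <= count (predC1 ga) w.
Proof.
elim: w e => //= g w IHw e.
by case: g => /=; rewrite ?add0n //; case: e => /=; rewrite ?add1n ?ltnS ?IHw //; apply: leqW.
Qed.

(** Each letter other than a contributes at most one letter to a section, and in an alternating word
    at most every second letter is of this kind, up to the first one. *)
Lemma size_sect_alternating e w : sorted alternating w ->
  (size (sect e w)).*2 <= (size w).+1.
Proof.
have aux x p : path alternating x p ->
    (count (predC1 ga) (x :: p)).*2 <= size (x :: p) + (x != ga).
  elim: p x => [|y p IHp] x; first by case: x.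
  move=> /= /andP[xy /IHp]; rewrite /= doubleD => h.
  by move: xy h; rewrite /alternating; case: (x == ga); case: (y == ga) => //= _; lia.
case: w => [//|x p] /= /aux h.
have := size_sect_count e (x :: p); rewrite -leq_double => /leq_trans; apply.
apply: leq_trans h _; rewrite /=; case: (x != ga); lia.
Qed.

Lemma not_alternating w : ~~ sorted alternating w ->
  exists p x y s, w = p ++ [:: x; y] ++ s /\ ~~ alternating x y.
Proof.
case: w => // x p; elim: p x => //= y p IHp x; rewrite negb_and => /orP[xy|/IHp].
  by exists [::], x, y, p.
by case=> q [x' [y' [s [-> xy]]]]; exists (x :: q), x', y', s.
Qed.

Definition merge_letters (x y : abcd) : seq abcd :=
  rw_norm grig_rules 1 [:: x; y].

Lemma ar_trivial_word : exists c, forall w, trivial_act w ->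
  ar Gamma_t (c * (size w * size w)) (posw w) [::].
Proof.
have [c1 c1P] := ar_split_sections.
have [c2 c2P] : exists c, forall xy : abcd * abcd, arp c [:: xy.1; xy.2] (merge_letters xy.1 xy.2).
  by apply: arp_uniform => -[x y] /=; apply: peqv_rw_norm; exact: grig_rulesP.
have [c3 aa] := peqv_sq ga.
(* For m > 1 the sections of an alternating word of length m have length at most 2m/3, so their
   squares add up to at most 8/9 of m^2; the remaining ninth of C m^2 pays for the splitting, and
   [c2] for a merge. *)
pose C := 18 * (c1 * 2 + c3 + 2) + c2.
exists C => w; have [n] := ubnP (size w); elim: n w => // n IHn w; rewrite ltnS => wn wT.
have [alt|/not_alternating[p [x [y [s [wE xy]]]]]] := boolP (sorted alternating w); last first.
  have sz : size (merge_letters x y) < 2 by move: xy; case: (x); case: (y).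
  have step := arp_ctx p s (c2P (x, y)).
  (* The shorter word inherits triviality through the action at a large height [d], since sigma^d
     reflects triviality. *)
  have [d dP] := eqv_run_eq (ex_intro (fun k => ar Gamma_t k _ _) _ step).
  have w'T : trivial_act (p ++ merge_letters x y ++ s).
    apply/(trivial_act_iter d) => v.
    have := dP d v (leqnn d); rewrite !run_posw => -[<-].
    by have := proj1 (trivial_act_iter d w) wT v; rewrite wE.
  have w's : (size (p ++ merge_letters x y ++ s)).+1 <= size w.
    by rewrite wE !size_cat /=; lia.
  have := IHn _ (leq_trans w's wn) w'T; move: w's; set m := size (_ ++ _) => w's ih.
  apply: (@ar_le _ _ (c2 + C * (m * m))).
    have : m * m + 1 <= size w * size w by nia.
    by rewrite /C; nia.
  by rewrite wE; exact: ar_trans step ih.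
case: w wn wT alt => [_ _ _|x [wn xT _|y w]]; first exact: Ar0.
  (* No single letter is trivial: a, b and c move the first of these vertices, and d moves the
     second. *)
  exfalso; move: (xT [:: false; false; false]) (xT [:: true; false; false]).
  by case: (x).
set u := [:: x, y & w] => wn uT alt; set m := size u in wn *.
have m2 : 1 < m by [].
have [_ uS] := proj1 (trivial_actP u) uT.
have hs e : (size (sect e u)).*2 <= m.+1 by exact: size_sect_alternating.
have ih e : ar Gamma_t (C * (size (sect e u) * size (sect e u))) (posw (sect e u)) [::].
  by apply: IHn (uS e); have := hs e; lia.
apply: (@ar_le _ _ (c1 * (m * m + 1) + (C * (size (sect true u) * size (sect true u)) +
  (1 + (C * (size (sect false u) * size (sect false u)) + (1 + c3)))))).
  have sq e : 9 * (2 * (size (sect e u) * size (sect e u))) <= 8 * (m * m).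
    have h3 : 3 * size (sect e u) <= 2 * m by have := hs e; lia.
    by clear -h3; nia.
  have := sq true; have := sq false; set a := _ * size (sect false u).
  set b := _ * size (sect true u); rewrite /C.
  have M0 : 0 < m * m by rewrite muln_gt0 (ltnW m2).
  move: (m * m) M0 => M; clear; move=> M0 ha hb.
  have : (18 * (c1 * 2 + c3 + 2) + c2) * (9 * (2 * a) + 9 * (2 * b)) <=
    (18 * (c1 * 2 + c3 + 2) + c2) * (16 * M) by rewrite leq_mul2l; apply/orP; right; lia.
  by nia.
apply: ar_trans (c1P u uT) _.
apply: ar_trans (ar_ctx [:: tp] _ (ih true)) _.
apply: ar_trans (ar_cancel _ [::] tp _) _.
apply: ar_trans (ar_ctx ([:: gen (Some ga)] ++ [:: tp]) ([:: tm] ++ posw [:: ga]) (ih false)) _.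
apply: ar_trans (ar_cancel _ [:: gen (Some ga)] tp _) _.
exact: aa.
Qed.

(** * Moving the letter t *)


(** sigma permutes b, c, d, and sigma(a) = aca, so the length of sigma^n(a) doubles and grows by one
    at each step: it is 2^(n+1) - 1. *)
Lemma size_iter_sigmaw n g : (size (iter n sigmaw [:: g])).+1 <= 2 ^ n.+1.
Proof.
have bcd h g' : g' != ga -> size (iter h sigmaw [:: g']) = 1.
  elim: h g' => // h IHh g'; rewrite iterSr; case: g' => // _; exact: IHh.
have pos h : 1 < 2 ^ h.+1 by rewrite -{1}(expn0 2) ltn_exp2l.
elim: n g => [|n IHn] g; first by [].
case gE: (g == ga); last by rewrite bcd ?gE.
rewrite (eqP gE) iterSr -[sigmaw _]/([:: ga] ++ [:: gc] ++ [:: ga]) !iter_sigmaw_cat.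
by rewrite !size_cat (bcd n gc) // [in X in _ <= X]expnS; have := IHn ga; lia.
Qed.

Definition heights_word (s : seq (nat * abcd)) : seq abcd :=
  flatten [seq iter x.1 sigmaw [:: x.2] | x <- s].

Lemma size_heights_word K s : all (fun x => x.1 <= K) s ->
  size (heights_word s) <= size s * 2 ^ K.+1.
Proof.
elim: s => // x s IHs /= /andP[xK /IHs{}IHs].
rewrite /heights_word /= size_cat mulSn leq_add //.
apply: leq_trans (ltnW (size_iter_sigmaw x.1 x.2)) _.
by rewrite leq_exp2l.
Qed.

(** The word is read from the right. A letter g in front of t^-p becomes sigma^p(g) behind it; a
    letter t cancels against t^-p if p > 0, and otherwise crosses the middle word and applies sigma
    to all of it. *)
Fixpoint t_normal (w : word abcdt) : nat * seq (nat * abcd) * nat :=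
  if w is l :: w' then
    let: (p, s, q) := t_normal w' in
    match l with
    | (Some g, _) => (p, (p, g) :: s, q)
    | (None, true) => (p.+1, s, q)
    | (None, false) =>
        if p is p'.+1 then (p', s, q) else (0, [seq (x.1.+1, x.2) | x <- s], q.+1)
    end
  else (0, [::], 0).

Definition t_normal_word (n : nat * seq (nat * abcd) * nat) : word abcdt :=
  nseq n.1.1 tm ++ posw (heights_word n.1.2) ++ nseq n.2 tp.

Definition t_count (w : word abcdt) := count_mem tp w.
Definition tV_count (w : word abcdt) := count_mem tm w.
Definition g_count (w : word abcdt) := count (fun l => l.1 != None) w.

Lemma size_counts w : size w = g_count w + t_count w + tV_count w.
Proof.
rewrite /g_count /t_count /tV_count; elim: w => // l w /= ->.
by case: l => [[g|] []] /=; lia.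
Qed.

(** The bound [p + t_count w] carries the induction: when t meets p = 0 and all heights rise, it
    keeps them below the number of letters t, as the last bound requires. *)
Lemma t_normal_bounds w : let: (p, s, q) := t_normal w in
  [/\ p <= tV_count w, q + tV_count w = p + t_count w, size s = g_count w,
      all (fun x => x.1 <= p + t_count w) s &
      all (fun x => x.1 <= maxn (t_count w) (tV_count w)) s].
Proof.
rewrite /g_count /t_count /tV_count; elim: w => //= l w.
case: (t_normal w) => [[p s] q] [h1 h2 h3 /allP h4 /allP h5].
case: l => [[g|] b] /=.
- rewrite !add0n h3; split=> //; rewrite ?leq_addr ?leq_max ?h1 ?orbT //=; exact/allP.
- case: b => /=; rewrite ?add0n ?add1n.
    split; rewrite ?ltnS ?h1 ?addnS ?h2 ?addSn //.
      by apply/allP => x /h4; apply: leqW.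
    by apply/allP => x /h5; rewrite !leq_max => /orP[->//|h]; rewrite (leqW h) orbT.
  case: p h1 h2 h4 => [|p] h1 h2 h4.
    split; rewrite ?size_map ?addSn ?h2 //.
      by rewrite all_map; apply/allP => x /h4.
    by rewrite all_map; apply/allP => x /h4 h /=; rewrite leq_max ltnS h.
  split; rewrite ?(ltnW h1) ?h2 ?addnS ?addSn //.
    by apply/allP => x /h4; rewrite addSn.
  by apply/allP => x /h5; rewrite !leq_max => /orP[h|->]; rewrite ?(leqW h) ?orbT.
Qed.

Lemma ar_word_tV : exists c, forall w,
  ar Gamma_t (c * (size w).+1) (posw w ++ [:: tm]) (tm :: posw (sigmaw w)).
Proof.
have [c cP] := ar_t_word; exists (c + 2) => w.
apply: (@ar_le _ _ (1 + (c * size w + 1))); first by nia.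
apply: ar_trans (ar_sym (ar_cancel Gamma_t [::] tm (posw w ++ [:: tm]))) _.
apply: (@ar_trans _ _ _ _ _ (tm :: posw (sigmaw w) ++ [:: tp; tm])).
  by have := ar_ctx [:: tm] [:: tm] (cP w); rewrite /= -!catA.
by have := ar_cancel Gamma_t (tm :: posw (sigmaw w)) tp [::]; rewrite !cats0.
Qed.

Lemma rcons_nseq_cat (T : Type) n (x : T) : nseq n x ++ [:: x] = nseq n.+1 x.
Proof. by elim: n => //= n ->. Qed.

(** The lengths of the successive sigma^i(g) are bounded by a geometric progression, so the last
    crossing dominates the cost. *)
Lemma ar_letter_tV : exists c, forall g p,
  ar Gamma_t (c * 2 ^ p.+1) (posw [:: g] ++ nseq p tm)
    (nseq p tm ++ posw (iter p sigmaw [:: g])).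
Proof.
have [c cP] := ar_word_tV; exists c => g; elim=> [|p IHp].
  by rewrite cats0; exact: Ar0.
rewrite -rcons_nseq_cat.
apply: (@ar_le _ _ (c * 2 ^ p.+1 + c * (size (iter p sigmaw [:: g])).+1)).
  by rewrite [2 ^ p.+2]expnS mul2n -addnn mulnDr leq_add2l leq_mul2l size_iter_sigmaw orbT.
apply: (@ar_trans _ _ _ _ _ (nseq p tm ++ posw (iter p sigmaw [:: g]) ++ [:: tm])).
  by have := ar_ctx [::] [:: tm] IHp; rewrite /= -!catA.
by have := ar_ctx (nseq p tm) [::] (cP (iter p sigmaw [:: g])); rewrite !cats0 -!catA.
Qed.

Lemma eqv_letter_sign g b : eqv Gamma_t [:: (Some g, b)] (posw [:: g]).
Proof.
case: b; last exact: eqv_refl.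
apply: eqv_sym; apply: eqv_split; exact: peqv_sq.
Qed.

Lemma ar_t_normal : exists c, forall K M w, t_count w <= K -> tV_count w <= K ->
  g_count w <= M ->
  ar Gamma_t (c * (size w * (M.+1 * 2 ^ K.+1))) w (t_normal_word (t_normal w)).
Proof.
have [c1 c1P] := ar_letter_tV; have [c2 c2P] := ar_t_word.
have [c3 c3P] : exists c, forall l : abcd * bool, l \in enum {: abcd * bool} ->
    ar Gamma_t c [:: (Some l.1, l.2)] (posw [:: l.1]).
  apply: bounded_choice => [m n l mn|l _]; first exact: ar_le.
  exact: eqv_letter_sign.
(* [B] is the budget for one letter, up to a constant: 2^(K+1) covers moving a letter g behind t^-p,
   and M 2^(K+1) bounds the word that a letter t may have to cross. *)
exists (c1 + c2 + c3 + 1) => K M; set B := M.+1 * 2 ^ K.+1.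
have K0 : 0 < 2 ^ K.+1 by rewrite expn_gt0.
have B0 : 0 < B by rewrite muln_gt0.
elim=> [|l w IHw] tK tVK gM; first exact: Ar0.
have {}IHw : ar Gamma_t ((c1 + c2 + c3 + 1) * (size w * B)) w (t_normal_word (t_normal w)).
  apply: IHw.
  - by apply: leq_trans tK; rewrite /t_count /= leq_addl.
  - by apply: leq_trans tVK; rewrite /tV_count /= leq_addl.
  - by apply: leq_trans gM; rewrite /g_count /= leq_addl.
apply: (@ar_le _ _ ((c1 + c2 + c3 + 1) * (size w * B) + (c1 + c2 + c3 + 1) * B)).
  by rewrite [size (l :: w)]/= mulSn mulnDr addnC.
apply: ar_trans; first by have := ar_ctx [:: l] [::] IHw; rewrite !cats0; exact.
have := t_normal_bounds w; rewrite /=; case: (t_normal w) => [[p s] q] [h1 h2 h3 h4 h5].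
case: l tK tVK gM => [[g|] b]; rewrite /t_count /tV_count /g_count /= => tK tVK gM.
- apply: (@ar_le _ _ (c3 + c1 * 2 ^ p.+1)).
    have pB : 2 ^ p.+1 <= B.
      apply: leq_trans (leq_pmull _ _) => //; rewrite leq_exp2l // ltnS.
      by apply: leq_trans h1 _; move: tVK; rewrite add0n.
    by nia.
  apply: (@ar_trans _ _ _ _ _ (posw [:: g] ++ t_normal_word (p, s, q))).
    have gbE : (g, b) \in enum {: abcd * bool} by rewrite mem_enum.
    by have := ar_ctx [::] (t_normal_word (p, s, q)) (c3P _ gbE).
  have := ar_ctx [::] (posw (heights_word s) ++ nseq q tp) (c1P g p).
  by rewrite /t_normal_word /heights_word /= posw_cat -!catA.
- case: b tK tVK => /= tK tVK; first exact: Ar0.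
  case: p h1 h2 h4 => [|p] h1 h2 h4; last first.
    by apply: (ar_le _ (ar_cancel _ [::] tp _)); nia.
  have sB : size (heights_word s) <= B.
    apply: leq_trans (size_heights_word (K := K) _) _.
      apply/allP => x /(allP h5) /leq_trans; apply.
      by rewrite geq_max; move: tK tVK; rewrite !(add0n, add1n) => /ltnW -> ->.
    by rewrite h3 leq_mul2r; apply/orP; right; move: gM; rewrite add0n => /leqW.
  apply: (@ar_le _ _ (c2 * size (heights_word s))); first by nia.
  have -> : t_normal_word (0, [seq (x.1.+1, x.2) | x <- s], q.+1) =
      (posw (sigmaw (heights_word s)) ++ [:: tp]) ++ nseq q tp.
    rewrite /t_normal_word /= -catA; congr (posw _ ++ _).
    by elim: (s) => //= x s' IHs; rewrite /heights_word /= sigmaw_cat -IHs.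
  exact: (ar_ctx [::] (nseq q tp) (c2P (heights_word s))).
Qed.

Lemma run_nseq_t h x n : run (h, x) (nseq n tp) = (h + n, x).
Proof. by elim: n h => [|n IHn] h; rewrite ?addn0 //= [LHS]IHn addnS. Qed.

Lemma run_nseq_tV h x n : run (h, x) (nseq n tm) = (h - n, x).
Proof.
elim: n h => [|n IHn] h; first by rewrite subn0.
have -> : h - n.+1 = h.-1 - n by lia.
exact: IHn.
Qed.

(** Started at height N + p, the normal form descends to N, acts there as sigma^N of its middle
    word, and ends at height N + q. Comparison with the identity gives p = q, and sigma^N reflects
    triviality. *)
Lemma t_normal_trivial w : in_ncl Gamma_t w ->
  let: (p, s, q) := t_normal w in p = q /\ trivial_act (heights_word s).
Proof.
move=> /in_ncl_eqv w0; have [c cP] := ar_t_normal.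
have := cP (size w) (size w) w (count_size _ _) (count_size _ _) (count_size _ _).
case: (t_normal w) => [[p s] q] wn.
have nf0 : eqv Gamma_t (t_normal_word (p, s, q)) [::].
  by apply: eqv_trans w0; apply: eqv_sym; exists (c * (size w * ((size w).+1 * 2 ^ (size w).+1))).
have [N NP] := eqv_run_eq nf0.
have E x := NP (N + p) x (leq_addr _ _).
have E' x : (N + q, act (iter N sigmaw (heights_word s)) x) = (N + p, x).
  by rewrite -[RHS]/(run (N + p, x) [::]) -E /t_normal_word !run_cat run_nseq_tV /= addnK
    run_posw run_nseq_t.
split; first by have [] := E' [::]; lia.
by apply/(trivial_act_iter N) => x; have [] := E' x.
Qed.

Lemma ar_cancel_t n : ar Gamma_t n (nseq n tm ++ nseq n tp) [::].
Proof.
elim: n => [|n IHn]; first exact: Ar0.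
rewrite -rcons_nseq_cat -catA -[in X in ar _ X]addn1 addnC.
exact: ar_trans (ar_cancel _ (nseq n tm) tm (nseq n tp)) IHn.
Qed.

Lemma sq_leq_exp m : m * m <= 4 * 2 ^ m.
Proof.
elim: m => // m IHm; rewrite expnS.
case: m IHm => [|[|[|m]]] // IHm; nia.
Qed.

Lemma ar_Gamma_t : exists C, forall x w, 0 < x -> size w <= x -> in_ncl Gamma_t w ->
  ar Gamma_t (C * (2 ^ x * x)) w [::].
Proof.
have [c1 c1P] := ar_t_normal; have [c2 c2P] := ar_trivial_word.
exists (c1 * 2 + c2 * 16 + 1) => x w x0 wx w0.
have := t_normal_bounds w; have := t_normal_trivial w0.
have := c1P (t_count w) (g_count w) w (leqnn _).
have := size_counts w.
case: (t_normal w) => [[p s] q] sw ar1 [pq sT] [h1 h2 h3 h4 h5].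
have tE : t_count w = tV_count w by lia.
rewrite tE in sw ar1 h5.
have {}ar1 := ar1 (leqnn _) (leqnn _).
set m := g_count w in sw ar1 h3; set k := tV_count w in sw ar1 h5 h1.
have sK : all (fun x => x.1 <= k) s by move: h5; rewrite maxnn.
have lw := size_heights_word sK; rewrite h3 in lw.
have ar2 := c2P _ sT; set l := size (heights_word s) in lw ar2.
have mk : m + k + k <= x by rewrite -sw.
have e1 : m.+1 * 2 ^ k.+1 <= 2 * 2 ^ x.
  apply: (@leq_trans (2 ^ m * 2 ^ k.+1)); first by rewrite leq_mul2r ltn_expl ?orbT.
  by rewrite -expnD -expnS leq_exp2l //; lia.
(* From l <= m 2^(k+1) and m^2 <= 4 2^m one gets l^2 <= 16 2^(m+2k), and m + 2k <= x. *)
have e2 : l * l <= 16 * 2 ^ x.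
  apply: (leq_trans (leq_mul lw lw)); rewrite mulnACA.
  apply: (leq_trans (leq_mul (sq_leq_exp m) (leqnn _))).
  rewrite -(expnD 2 k.+1) -[4]/(2 ^ 2) -[16]/(2 ^ 4) -!expnD leq_exp2l //; lia.
apply: (@ar_le _ _ (c1 * (size w * (m.+1 * 2 ^ k.+1)) + (c2 * (l * l) + p))).
  have px : p <= x by lia.
  have tx : 0 < 2 ^ x by rewrite expn_gt0.
  rewrite !mulnDl mul1n -addnA -!mulnA; apply: leq_add; last apply: leq_add.
  - by rewrite leq_mul2l (leq_trans (leq_mul wx e1)) ?orbT // mulnC mulnA.
  - by rewrite leq_mul2l (leq_trans e2) ?orbT // mulnA leq_pmulr.
  - by apply: leq_trans px _; rewrite leq_pmull.
apply: ar_trans ar1 _.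
have := ar_ctx (nseq p tm) (nseq q tp) ar2 => /ar_trans; apply.
by rewrite /= -pq; exact: ar_cancel_t.
Qed.

Lemma diagram_Gamma_t : exists C, forall x w, 0 < x -> size w <= x -> in_ncl Gamma_t w ->
  has_diagram Gamma_t w (C * (2 ^ x * x)).
Proof.
have [C CP] := ar_Gamma_t; have [K KP] := has_diagram_Gamma_t.
exists (K * C.+1) => x w x0 wx w0; apply: has_diagram_le (KP _ _ (CP x w x0 wx w0)).
rewrite -mulnA leq_mul2l mulSn addnC -addn1 leq_add2l muln_gt0 expn_gt0 x0.
by rewrite orbT.
Qed.

(** * Dehn functions *)


Lemma nat_minimum (Q : nat -> Prop) : (exists n, Q n) ->
  exists n, Q n /\ forall m, Q m -> n <= m.
Proof.
case=> n; elim/ltn_ind: n => n IHn Qn.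
case: (classic (exists2 m, m < n & Q m)) => [[m mn Qm]|nQ]; first exact: IHn mn Qm.
exists n; split=> // m Qm; rewrite leqNgt; apply/negP => mn; apply: nQ; by exists m.
Qed.

Lemma nat_maximum (Q : nat -> Prop) B : (exists n, Q n) -> (forall n, Q n -> n <= B) ->
  exists n, Q n /\ forall m, Q m -> m <= n.
Proof.
move=> [n Qn] QB; have [|k [[j Qj Bjk] kmin]] := @nat_minimum (fun k => exists2 j, Q j & B - j = k).
  by exists (B - n), n.
exists j; split=> // m Qm; have := kmin _ (ex_intro2 _ _ m Qm erefl).
by have := QB _ Qm; have := QB _ Qj; lia.
Qed.

Lemma is_L_exists (A : finType) (P : presentation A) j w n : has_diagram P w n ->
  exists2 m, m <= n & is_L P j w m.
Proof.
case=> D [Dw Dn].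
have [|m [[D' [D'w D'm]] mmin]] := @nat_minimum (fun m =>
    exists D : van_kampen_diagram P, boundary_label D w /\ ncells j D = m).
  by exists (ncells j D), D.
exists m; first by apply: leq_trans (Dn j); apply: mmin; exists D.
by split=> [|D'' D''w]; [exists D'|apply: mmin; exists D''].
Qed.

Lemma is_L_unique (A : finType) (P : presentation A) j w m n :
  is_L P j w m -> is_L P j w n -> m <= n.
Proof. by move=> [_ h] [[D [Dw <-]] _]; exact: h. Qed.

(** A common bound on diagrams makes every L_j(W) exist and bounds the values; the empty word shows
    that there are some, so the maximum is attained. *)
Lemma is_dehn_exists (A : finType) (P : presentation A) j x B :
  (forall w, in_ncl P w -> size w <= x -> has_diagram P w B) ->
  exists2 m, m <= B & is_dehn P j x m.
Proof.
move=> PB; pose Q m := exists w, [/\ in_ncl P w, size w <= x & is_L P j w m].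
have QB m : Q m -> m <= B.
  move=> [w [w0 wx wm]]; have [n nB wn] := is_L_exists j (PB w w0 wx).
  exact: leq_trans (is_L_unique wm wn) nB.
have [|m [Qm mmax]] := nat_maximum _ QB.
  have [n _ wn] := is_L_exists j (PB [::] (NclOne P) isT).
  by exists n, [::]; split=> //; exact: NclOne.
exists m; first exact: QB.
split=> // [w w0 wx|w n w0 wx wn].
  by have [n _ wn] := is_L_exists j (PB w w0 wx); exists n.
by apply: mmax; exists w.
Qed.

Import Order.TTheory GRing.Theory Num.Theory.
Local Open Scope ring_scope.

Theorem corollary1p9 (R : realType) :
  exists C2 : R, 1 < C2 /\
    forall (j : 'I_3) (x : nat), (1 <= x)%N ->
      exists fx : nat, is_dehn Gamma_t j x fx /\
        fx%:R <= C2 * 2%:R ^+ x * x%:R.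
Proof.
have [C CP] := diagram_Gamma_t.
(* The added 2 ensures that the constant exceeds 1 even when [C] is 0. *)
exists C.+2%:R; split=> [|j x x0]; first by rewrite ltr1n.
have [|m mB mD] := @is_dehn_exists _ Gamma_t j x (C * (2 ^ x * x))%N.
  by move=> w w0 wx; exact: CP.
exists m; split=> //; rewrite -natrX -!natrM ler_nat.
by apply: leq_trans mB _; rewrite -mulnA leq_mul2r (leqW (leqnSn C)) orbT.
Qed.
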